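(* Let $F$ be a finite field with $|F|=q$. Let $n_1,n_2,\dots$ be odd integers $>1$ coprime to $q$ such that $\lim_{i\to\infty}\frac{\log_q n_i}{\mu_q(n_i)}=0$. Let $G_i$ be any abelian group of order $n_i$ for $i=1,2,\dots$. Then for $i=1,2,\dots$ there exist self-orthogonal $2$-quasi-$FG_i$ codes $C_i$ of type $I^\dagger$ (hence $\dim C_i=n_i-1$) such that the code sequence $C_1,C_2,\dots$ is asymptotically good.
   Context: For an integer $n>1$ coprime to $q$, the $q$-cyclotomic cosets of $\mathbb{Z}_n=\mathbb{Z}/n\mathbb{Z}$ are the orbits of multiplication by $q$ on $\mathbb{Z}_n$; $\{0\}$ is the trivial one, and $\mu_q(n)$ is the minimal size of the non-trivial $q$-cyclotomic cosets. For an abelian group $G$ of order $n$, $FG$ is the group algebra; $a=\sum_{x\in G}a_xx\in FG$ is identified with the word $(a_x)_{x\in G}\in F^n$, and $(FG)^2=FG\times FG$ with $F^{2n}$. For $a=\sum a_xx$ put $\overline a=\sum a_xx^{-1}$. The Hamming weight $\mathrm{w}(a,b)$ of $(a,b)\in(FG)^2$ is the number of nonzero coordinates among the $2n$ coordinates. The inner product on $(FG)^2$ is the Euclidean one: $\langle(a,b),(a',b')\rangle=\sum_{x\in G}(a_xa'_x+b_xb'_x)$. A $2$-quasi-$FG$ code is an $FG$-submodule $C$ of $(FG)^2$; it is self-orthogonal if $C\subseteq C^\perp$. Its rate is $R(C)=\frac{\dim_F C}{2n}$ and its relative minimum distance is $\Delta(C)=\frac{\mathrm{w}(C)}{2n}$,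 where $\mathrm{w}(C)$ is the minimum Hamming weight of the nonzero elements of $C$. Let $e_0=\frac1n\sum_{x\in G}x$, $1^\dagger=1-e_0$ and $FG^\dagger=FG\cdot 1^\dagger$. A self-orthogonal $2$-quasi-$FG$ code of type $I^\dagger$ is a code of the form $C_{1^\dagger,b^\dagger}=\{(u1^\dagger,ub^\dagger)\mid u\in FG\}$ with $b^\dagger\in FG^\dagger$ and $b^\dagger\,\overline{b^\dagger}=-1^\dagger$. A code sequence $C_1,C_2,\dots$ is asymptotically good if the length of $C_i$ goes to infinity and both $R(C_i)$ and $\Delta(C_i)$, $i=1,2,\dots$, are bounded from below by a positive constant. *)

(* Defs.v *)
From HB Require Import structures.
From mathcomp Require Import all_boot all_order all_algebra fingroup.
Set Implicit Arguments.
Unset Strict Implicit.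
Unset Printing Implicit Defensive.
Import Order.TTheory GRing.Theory Num.Theory.
Local Open Scope ring_scope.

Section CyclotomicCosets.
Variables q n : nat.

(* 'Z_n is Z/nZ only for 1 < n. *)
Definition qmult (x : 'Z_n) : 'Z_n := q%:R * x.

Definition cyclotomic_coset (x : 'Z_n) : {set 'Z_n} :=
  [set y in orbit qmult x].

Definition cyclotomic_cosets : {set {set 'Z_n}} :=
  [set cyclotomic_coset x | x : 'Z_n].

(* n bounds the size of every coset, so it is a harmless initial value: for
   1 < n there is a non-trivial coset. *)
Definition mu_q : nat :=
  \big[minn/n]_(Q in cyclotomic_cosets | Q != [set 0]) #|Q|.

End CyclotomicCosets.

(* a : galg F gT stands for \sum_x (a x) x.  F^o rather than F makes the
   function type an F-vector space. *)
Definition galg (F : finFieldType) (gT : finGroupType) : Type :=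
  {ffun gT -> F^o}.

Section GroupAlgebra.
Variables (F : finFieldType) (gT : finGroupType).
Local Notation FG := (galg F gT).

HB.instance Definition _ := Finite.on FG.
HB.instance Definition _ := Vector.on FG.

Definition gcoef (a : FG) (x : gT) : F := (a : {ffun gT -> F^o}) x.

Definition gelt (x : gT) : FG := [ffun y => (y == x)%:R].

Definition gmul (a b : FG) : FG :=
  [ffun z => \sum_(x : gT) gcoef a x * gcoef b (x^-1 * z)%g].

Lemma gelt_sum (a : FG) : a = \sum_(x : gT) gcoef a x *: gelt x.
Proof.
apply/ffunP=> y; rewrite sum_ffunE (bigD1 y) //= !ffunE eqxx.
rewrite big1 => [|x /negbTE nxy]; last by rewrite !ffunE eq_sym nxy scaler0.
by rewrite addr0 /GRing.scale /= mulr1.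
Qed.

Lemma gcoefE (f : gT -> F) x : gcoef [ffun y => f y] x = f x.
Proof. exact: ffunE. Qed.

Lemma gcoefD (a b : FG) x : gcoef (a + b) x = gcoef a x + gcoef b x.
Proof. exact: ffunE. Qed.

Lemma gcoefP (a b : FG) : gcoef a =1 gcoef b -> a = b.
Proof. by move=> eq_ab; apply/ffunP. Qed.

Lemma gcoef_gmul (a b : FG) z :
  gcoef (gmul a b) z = \sum_(y : gT) gcoef a (z * y^-1)%g * gcoef b y.
Proof.
rewrite gcoefE.
have inj : injective (fun y : gT => z * y^-1)%g by move=> x y /mulgI /invg_inj.
rewrite (reindex_inj inj) /=; apply: eq_bigr => y _.
by rewrite invMg invgK mulgKV.
Qed.

Lemma gmulA : associative gmul.
Proof.
move=> a b c; apply: gcoefP => z; rewrite [LHS]gcoefE [RHS]gcoef_gmul.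
under eq_bigr => x _ do rewrite gcoef_gmul big_distrr /=.
rewrite exchange_big /=; apply: eq_bigr => y _.
rewrite gcoefE big_distrl /=; apply: eq_bigr => x _.
by rewrite mulrA mulgA.
Qed.

Lemma gmul1g : left_id (gelt 1%g) gmul.
Proof.
move=> a; apply: gcoefP => z; rewrite gcoefE (bigD1 1%g) //= big1 => [|x nx1].
  by rewrite gcoefE eqxx mul1r invg1 mul1g addr0.
by rewrite gcoefE (negbTE nx1) mul0r.
Qed.

Lemma gmulg1 : right_id (gelt 1%g) gmul.
Proof.
move=> a; apply: gcoefP => z; rewrite gcoef_gmul (bigD1 1%g) //=.
rewrite big1 => [|x nx1]; first by rewrite gcoefE eqxx mulr1 invg1 mulg1 addr0.
by rewrite gcoefE (negbTE nx1) mulr0.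
Qed.

Lemma gmulDl : left_distributive gmul +%R.
Proof.
move=> a b c; apply: gcoefP => z; rewrite gcoefD !gcoefE -big_split /=.
by apply: eq_bigr => x _; rewrite gcoefD mulrDl.
Qed.

Lemma gmulDr : right_distributive gmul +%R.
Proof.
move=> a b c; apply: gcoefP => z; rewrite gcoefD !gcoefE -big_split /=.
by apply: eq_bigr => x _; rewrite gcoefD mulrDr.
Qed.

Lemma gelt1_neq0 : gelt 1%g != 0 :> FG.
Proof.
by apply/eqP=> /ffunP/(_ 1%g); rewrite !ffunE eqxx => /eqP; rewrite oner_eq0.
Qed.

HB.instance Definition _ := GRing.Zmodule_isNzRing.Build FG
  gmulA gmul1g gmulg1 gmulDl gmulDr gelt1_neq0.

Lemma gcoefZ (k : F) (a : FG) x : gcoef (k *: a) x = k * gcoef a x.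
Proof. exact: ffunE. Qed.

Lemma gcoefM (a b : FG) z :
  gcoef (a * b) z = \sum_(x : gT) gcoef a x * gcoef b (x^-1 * z)%g.
Proof. exact: gcoefE. Qed.

Lemma galg_scalerAl (k : F) (a b : FG) : k *: (a * b) = (k *: a) * b.
Proof.
apply: gcoefP => z; rewrite gcoefZ !gcoefM mulr_sumr.
by apply: eq_bigr => x _; rewrite gcoefZ mulrA.
Qed.

HB.instance Definition _ := GRing.Lmodule_isLalgebra.Build F FG galg_scalerAl.

Lemma galg_scalerAr (k : F) (a b : FG) : k *: (a * b) = a * (k *: b).
Proof.
apply: gcoefP => z; rewrite gcoefZ !gcoefM mulr_sumr.
by apply: eq_bigr => x _; rewrite gcoefZ mulrCA.
Qed.

HB.instance Definition _ := GRing.Lalgebra_isAlgebra.Build F FG galg_scalerAr.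

Lemma geltM (x y : gT) : gelt (x * y)%g = gelt x * gelt y.
Proof.
apply: gcoefP => z; rewrite gcoefE gcoefM (bigD1 x) //= !gcoefE eqxx mul1r.
rewrite big1 => [|t ntx]; last by rewrite gcoefE (negbTE ntx) mul0r.
rewrite addr0; congr (nat_of_bool _)%:R.
by apply/eqP/eqP=> [->|<-]; rewrite ?mulKg ?mulKVg.
Qed.

Definition bar (a : FG) : FG := \sum_(x : gT) gcoef a x *: gelt x^-1%g.

Definition e0 : FG := (#|gT|%:R : F)^-1 *: \sum_(x : gT) gelt x.

Definition one_dag : FG := 1 - e0.

Definition FGdag : {set FG} := [set a * one_dag | a : FG].

Definition gweight (a : FG) : nat := #|[set x : gT | gcoef a x != 0]|.

Definition weight (c : FG * FG) : nat := (gweight c.1 + gweight c.2)%N.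

Definition inner (c d : FG * FG) : F :=
  \sum_(x : gT) (gcoef c.1 x * gcoef d.1 x + gcoef c.2 x * gcoef d.2 x).

Implicit Type C : {vspace (FG * FG)%type}.

(* An F-subspace stable under FG, i.e. an FG-submodule of (FG)^2. *)
Definition quasi_code2 C : Prop :=
  forall (u : FG) (c : FG * FG), c \in C -> (u * c.1, u * c.2) \in C.

Definition dual_code C : {set FG * FG} :=
  [set c | [forall d, (d \in C) ==> (inner d c == 0)]].

Definition self_orthogonal C : Prop := {subset C <= dual_code C}.

Definition code_gen2 (a b : FG) : {set FG * FG} :=
  [set (u * a, u * b) | u : FG].

Definition type_I_dag C : Prop :=
  exists b : FG, [/\ b \in FGdag, b * bar b = - one_dag
                   & C =i code_gen2 one_dag b].

Definition code_length C : nat := (2 * #|gT|)%N.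

(* The zero code gets the convention weight code_length; it has rate 0. *)
Definition min_weight C : nat :=
  \big[minn/code_length C]_(c : FG * FG | (c \in C) && (c != 0)) weight c.

End GroupAlgebra.

From mathcomp Require Import all_classical all_reals all_analysis.
Import numFieldNormedType.Exports.

Definition code_rate (R : realType) (F : finFieldType) (gT : finGroupType)
    (C : {vspace (galg F gT * galg F gT)%type}) : R :=
  (\dim C)%:R / (code_length C)%:R.

Definition rel_distance (R : realType) (F : finFieldType) (gT : finGroupType)
    (C : {vspace (galg F gT * galg F gT)%type}) : R :=
  (min_weight C)%:R / (code_length C)%:R.

Definition asymptotically_good (R : realType) (F : finFieldType)
    (G : nat -> finGroupType)
    (C : forall i, {vspace (galg F (G i) * galg F (G i))%type}) : Prop :=
  [/\ ((fun i => code_length (C i)) @ \oo --> \oo)%classic,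
      exists2 r : R, 0 < r & forall i, r <= code_rate R (C i)
    & exists2 d : R, 0 < d & forall i, d <= rel_distance R (C i)].

Definition logb (R : realType) (b x : R) : R := ln x / ln b.

(* Main.v *)
(* We count. FG is a finite commutative ring in which x^(N+1) = x for
   N + 1 = q^phi(n) (this power fixes the scalars and, as q^phi(n) = 1 mod n,
   the group), so x^N is the idempotent generating the ideal of x. Maximising
   such idempotents gives a Hilbert 90 theorem for the involution bar; as
   |G| is odd, bar is nontrivial on every nonzero ideal of FG^dagger, and it
   follows that a bar-invariant ideal A of dimension k has at most q^(k/2)
   symmetric elements and about q^(k/2) or more unitary ones, and that the set
   D of all b with b * bar b = - 1^dagger is nonempty.
   For a <> 0 let A be the bar-invariant ideal generated by a. The unitary
   group of A acts freely on D and moves a b, so a given word (a, d) lies in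
   C_b for a proportion at most 1 / |unitary A| of the b in D. By averaging an
   information set over G, A x A contains few words of small relative weight.
   Every primitive idempotent of FG^dagger spans an ideal of dimension at least
   mu_q(n), so there are at most n^j ideals with j simple summands, each of
   dimension at least j mu_q(n). When n is a small power of q^mu_q(n), the
   proportions sum to less than 1 and some C_b has no light word. *)
Require Import Defs.
From HB Require Import structures.
From mathcomp Require Import all_boot all_order all_algebra all_fingroup.
From mathcomp Require Import all_solvable all_field.
From mathcomp Require Import ring zify.
Set Implicit Arguments.
Unset Strict Implicit.
Unset Printing Implicit Defensive.
Import Order.TTheory GRing.Theory.
Local Open Scope ring_scope.

(** * Elementary counting *)

Section Fibres.
Variables (T T' : finType) (X : {set T}) (Y : {set T'}) (h : T -> T') (c : nat).
Hypothesis hXY : forall x, x \in X -> h x \in Y.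

Lemma card_fibres : #|X| = (\sum_(y in Y) #|[set x in X | h x == y]|)%N.
Proof.
rewrite -sum1_card (partition_big h (mem Y)) //=; apply: eq_bigr => y _.
by rewrite -sum1_card; apply: eq_bigl => x; rewrite inE.
Qed.

Lemma leq_card_fibres :
  (forall y, y \in Y -> #|[set x in X | h x == y]| <= c)%N -> (#|X| <= #|Y| * c)%N.
Proof.
by move=> le_c; rewrite card_fibres -sum_nat_const; apply: leq_sum => y /le_c.
Qed.

Lemma geq_card_fibres :
  (forall y, y \in Y -> c <= #|[set x in X | h x == y]|)%N -> (#|Y| * c <= #|X|)%N.
Proof.
by move=> le_c; rewrite card_fibres -sum_nat_const; apply: leq_sum => y /le_c.
Qed.

End Fibres.

Lemma leq_card_inj_in (T T' : finType) (X : {set T}) (Y : {set T'}) (h : T -> T') :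
  {in X &, injective h} -> {in X, forall x, h x \in Y} -> (#|X| <= #|Y|)%N.
Proof.
move=> inj_h hXY; rewrite -(card_in_imset inj_h); apply: subset_leq_card.
by apply/subsetP => _ /imsetP[x Xx ->]; apply: hXY.
Qed.

Lemma leq_card_bigcup (I T : finType) (P : pred I) (X : I -> {set T}) :
  (#|\bigcup_(i | P i) X i| <= \sum_(i | P i) #|X i|)%N.
Proof.
elim/big_rec2: _ => [|i m Y _ le_m]; first by rewrite cards0.
by apply: leq_trans (leq_card_setU _ _) _; rewrite leq_add2l.
Qed.

(** Bernoulli without fractions: (1 + 1/M)^j (1 - j/M) <= 1 by induction on [j], and at [j = m] the
    second factor exceeds 1/2. *)
Lemma expn_succ_lt2 m M : (2 * m < M)%N -> (M.+1 ^ m < 2 * M ^ m)%N.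
Proof.
move=> ltM; have step j : (j <= m)%N -> (M.+1 ^ j * (M - j) <= M ^ j.+1)%N.
  elim: j => [|j IH] lej; first by rewrite expn0 expn1 mul1n subn0.
  apply: (@leq_trans (M.+1 ^ j * (M - j) * M)).
    by rewrite expnSr -!mulnA leq_mul2l; apply/orP; right; nia.
  by rewrite [(M ^ j.+2)%N]expnSr leq_mul2r IH ?orbT // ltnW.
have := step m (leqnn m); rewrite expnS => le_m.
have pos : (0 < M ^ m)%N by rewrite expn_gt0; lia.
have : (M.+1 ^ m * (M - m) < 2 * M ^ m * (M - m))%N by nia.
by rewrite ltn_mul2r => /andP[].
Qed.

(** The binomial theorem, with the subsets grouped by size. It will bound a sum over idempotents,
    each encoded by its set of primitives. *)
Lemma sum_subsets_expn (T : finType) (P : {set T}) M :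
  (\sum_(X : {set T} | X \subset P) M ^ (#|P| - #|X|) = M.+1 ^ #|P|)%N.
Proof.
pose m := #|P|; rewrite -addn1 expnDn.
rewrite (partition_big (fun X : {set T} => inord #|X| : 'I_m.+1) predT) //=.
apply: eq_bigr => i _; rewrite exp1n muln1.
have in_i (X : {set T}) : X \subset P -> (inord #|X| == i) = (#|X| == i).
  by move=> /subset_leq_card leX; rewrite -val_eqE /= inordK.
rewrite -cards_draws -sum_nat_const; apply: eq_big => [X|X].
  rewrite inE.
  by case: (boolP (X \subset P)) => // sX; rewrite in_i.
by move=> /andP[sX]; rewrite in_i // => /eqP->.
Qed.

(** * Idempotents and unitary elements in a finite reduced ring *)

Section FiniteReducedRing.
Variables (R : finComNzRingType) (N : nat).
Hypotheses (N_gt0 : (0 < N)%N) (exprN1 : forall x : R, x ^+ N.+1 = x).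
Implicit Types x y e f p u a b : R.

Definition supp x := x ^+ N.
(** An inverse of [x] inside the ideal of [x]. The exponent [N.-1] alone would give 1 when
    [N = 1]. *)
Definition qinv x := x ^+ (N + N.-1).
Definition ideal e : {set R} := [set x | x * e == x].
Definition units_of e : {set R} := [set x in ideal e | supp x == e].

Lemma mulr_supp x : x * supp x = x.
Proof. by rewrite -exprS exprN1. Qed.

Lemma suppE x : supp x = x ^+ N.-1 * x.
Proof. by rewrite -exprSr prednK. Qed.

Lemma supp_idem x : supp x * supp x = supp x.
Proof. by rewrite {1}suppE -mulrA mulr_supp -suppE. Qed.

Lemma mulr_qinv x : x * qinv x = supp x.
Proof. by rewrite /qinv -exprS -addnS prednK // exprD supp_idem. Qed.

Lemma suppM x y : supp (x * y) = supp x * supp y.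
Proof. exact: exprMn. Qed.

Lemma supp_eq0 x : supp x = 0 -> x = 0.
Proof. by move=> s0; rewrite -(mulr_supp x) s0 mulr0. Qed.

Lemma supp_id e : e * e = e -> supp e = e.
Proof.
move=> ee; rewrite /supp; case: N N_gt0 => // m _.
by elim: m => [|m IH]; rewrite ?expr1 // exprS IH.
Qed.

Lemma supp_le x e : e * e = e -> x * e = x -> supp x * e = supp x.
Proof. by move=> ee xe; rewrite -{1}(supp_id ee) -suppM xe. Qed.

Lemma mulr_supp_eq0 x y : x * y = 0 -> supp x * y = 0.
Proof. by move=> xy; rewrite suppE -mulrA xy mulr0. Qed.

Lemma supp_mull c x : supp (c * x) * supp x = supp (c * x).
Proof. by rewrite suppM -mulrA supp_idem. Qed.

Lemma supp_assoc x y c d : x = c * y -> y = d * x -> supp x = supp y.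
Proof.
move=> xE yE; have sxy : supp x * supp y = supp x by rewrite xE supp_mull.
by rewrite -sxy mulrC [in LHS]yE supp_mull -yE.
Qed.

Lemma suppN x : supp (- x) = supp x.
Proof. by apply: (@supp_assoc _ _ (-1) (-1)); rewrite ?mulN1r ?opprK. Qed.

(** [supp (x + y)] acts as the identity on both orthogonal components [x] and [y]; conversely
    [supp x + supp y] is an idempotent that fixes [x + y]. *)
Lemma suppD x y : x * y = 0 -> supp (x + y) = supp x + supp y.
Proof.
move=> xy0; have sxy := mulr_supp_eq0 xy0.
have syx : supp y * x = 0 by apply: mulr_supp_eq0; rewrite mulrC.
have ss0 : supp x * supp y = 0.
  by rewrite mulrC; apply: mulr_supp_eq0; rewrite mulrC.
have part z t : z * t = 0 -> supp (z + t) * supp z = supp z.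
  move=> zt0; rewrite -{1}(supp_id (supp_idem z)) -suppM mulrDl mulr_supp.
  by rewrite (mulrC t) mulr_supp_eq0 // addr0.
have <- : supp (x + y) * (supp x + supp y) = supp x + supp y.
  by rewrite mulrDr part // [in X in _ + X]addrC part // mulrC.
apply/esym/supp_le; first by rewrite !mulrDl !mulrDr !supp_idem ss0 mulrC ss0 addr0 add0r.
by rewrite mulrDl !mulrDr !mulr_supp (mulrC x) syx (mulrC y) sxy addr0 add0r.
Qed.

Lemma idealP e x : reflect (x * e = x) (x \in ideal e).
Proof. by rewrite inE; apply: eqP. Qed.

Lemma idealS e f : e * f = e -> ideal e \subset ideal f.
Proof.
by move=> ef; apply/subsetP => x /idealP xe; apply/idealP; rewrite -xe -mulrA ef.
Qed.

Lemma card_idealD e f : e * e = e -> f * f = f -> e * f = 0 ->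
  (#|ideal e| * #|ideal f| <= #|ideal (e + f)%R|)%N.
Proof.
move=> ee ff ef; rewrite -cardsX.
have fe : f * e = 0 by rewrite mulrC.
have annih x g h : x \in ideal g -> g * h = 0 -> x * h = 0.
  by move=> /idealP <- gh; rewrite -mulrA gh mulr0.
apply: (@leq_card_inj_in _ _ _ _ (fun z => z.1 + z.2)).
  move=> [x y] [x' y'] /setXP[/= xA yA] /setXP[/= xA' yA'] eq_s; congr pair.
    have /(congr1 ( *%R^~ e)) := eq_s; rewrite !mulrDl.
    by rewrite (annih y f) // (annih y' f) // !addr0 !(idealP _ _ _).
  have /(congr1 ( *%R^~ f)) := eq_s; rewrite !mulrDl.
  by rewrite (annih x e) // (annih x' e) // !add0r !(idealP _ _ _).
move=> [x y] /setXP[/= xA yA]; apply/idealP.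
rewrite mulrDl !mulrDr (annih x e f) // (annih y f e) // addr0 add0r.
by rewrite (idealP _ _ xA) (idealP _ _ yA).
Qed.

(** * Primitive idempotents below [o] *)

Section Primitive.
Variable o : R.

Definition primitives : {set R} :=
  [set p | [&& p * p == p, p * o == p, p != 0 &
     [forall f, (f * f == f) ==> (f * p == f) ==> (f == 0) || (f == p)]]].

Definition prims e : {set R} := [set p in primitives | p * e == p].

Lemma primitiveP p : p \in primitives ->
  [/\ p * p = p, p * o = p, p != 0 &
     forall f, f * f = f -> f * p = f -> f != 0 -> f = p].
Proof.
rewrite inE => /and4P[/eqP pp /eqP po p0 /forallP minp]; split=> // f ff fp f0.
by have := minp f; rewrite ff fp !eqxx (negPf f0) => /eqP.
Qed.

Lemma primsP e p : p \in prims e -> p \in primitives /\ p * e = p.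
Proof. by rewrite inE => /andP[? /eqP]. Qed.

(** A nonzero idempotent below [e] with the smallest ideal is primitive. *)
Lemma prims_neq0 e : e * e = e -> e * o = e -> e != 0 -> exists p, p \in prims e.
Proof.
move=> ee eo e0.
pose Q f := [&& f * f == f, f * e == f & f != 0].
have Qe : Q e by rewrite /Q ee eqxx e0.
case: (arg_minnP (fun f => #|ideal f|) Qe) => p /and3P[/eqP pp /eqP pe p0] min_p.
exists p; rewrite inE pe eqxx andbT inE pp eqxx p0 -{1}pe -mulrA eo pe eqxx /=.
apply/forallP => f; apply/implyP => /eqP ff; apply/implyP => /eqP fp.
apply/norP => -[f0 fp']; have Qf : Q f by rewrite /Q ff f0 -fp -mulrA pe eqxx.
have := min_p _ Qf; rewrite leqNgt proper_card //.
rewrite properE idealS //; apply/subsetPn; exists p; first by rewrite inE pp.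
by apply: contra fp' => /idealP; rewrite mulrC fp => ->.
Qed.

Lemma primitives_ortho p p' :
  p \in primitives -> p' \in primitives -> p != p' -> p * p' = 0.
Proof.
move=> /primitiveP[pp po p0 minp] /primitiveP[pp' po' p0' minp'] npp'.
apply/eqP; apply: contraNT npp' => n0.
have id : (p * p') * (p * p') = p * p' by rewrite mulrACA pp pp'.
have := minp _ id _ n0; rewrite mulrAC pp => /(_ erefl) <-; apply/eqP.
by apply: minp' => //; rewrite -mulrA pp'.
Qed.

Lemma sum_primitives_idem (X : {set R}) : X \subset primitives ->
  (\sum_(p in X) p) * (\sum_(p in X) p) = \sum_(p in X) p.
Proof.
move=> /subsetP sXP; rewrite mulr_suml; apply: eq_bigr => p Xp.
rewrite mulr_sumr (bigD1 p) //= big1 ?addr0.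
  by have [] := primitiveP (sXP _ Xp).
by move=> p' /andP[Xp' np]; apply: primitives_ortho; rewrite ?sXP // eq_sym.
Qed.

(** A primitive below the difference [e - s] would also be a summand of [s], hence orthogonal to
    [e - s], which is absurd. *)
Lemma sum_prims e : e * e = e -> e * o = e -> e = \sum_(p in prims e) p.
Proof.
move=> ee eo; set s := \sum_(p in _) p.
have sP : prims e \subset primitives by apply/subsetP => p /primsP[].
have ss : s * s = s := sum_primitives_idem sP.
have se : s * e = s.
  by rewrite mulr_suml; apply: eq_bigr => p /primsP[].
apply/eqP; rewrite -subr_eq0; apply/negPn/negP => f0.
have ff : (e - s) * (e - s) = e - s.
  by rewrite !(mulrBl, mulrBr) ee ss (mulrC e) se subrr subr0.
have fe : (e - s) * e = e - s by rewrite mulrBl ee se.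
have fo : (e - s) * o = e - s by rewrite -{1}fe -mulrA eo fe.
have [p /primsP[pP pf]] := prims_neq0 ff fo f0.
have [pp _ p0 _] := primitiveP pP; case/eqP: p0.
have pe : p * e = p by rewrite -pf -mulrA fe.
have pS : p \in prims e by rewrite inE pP pe /=.
rewrite -pf mulrBr pe /s mulr_sumr (bigD1 p) //= pp big1 ?addr0 ?subrr //.
move=> p' /andP[/primsP[Pp' _] np].
by apply: primitives_ortho => //; rewrite eq_sym.
Qed.

Lemma prims_inj e f : e * e = e -> e * o = e -> f * f = f -> f * o = f ->
  prims e = prims f -> e = f.
Proof.
by move=> ee eo ff fo eq_ef; rewrite (sum_prims ee eo) eq_ef -sum_prims.
Qed.

Variable B : nat.
Hypothesis leB : forall p, p \in primitives -> (B <= #|ideal p|)%N.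

Lemma card_ideal_sum (X : {set R}) : X \subset primitives ->
  (B ^ #|X| <= #|ideal (\sum_(p in X) p)%R|)%N.
Proof.
have [m] := ubnP #|X|; elim: m X => // m IH X lt_m /[dup] sX /subsetP sXP.
have [->|[p Xp]] := set_0Vmem X.
  rewrite cards0 big_set0 expn0 card_gt0; apply/set0Pn.
  by exists 0; rewrite inE mulr0.
have sYP : X :\ p \subset primitives by apply: subset_trans sX; apply: subD1set.
have leY := IH (X :\ p) _ sYP; rewrite (cardsD1 p) Xp in lt_m *.
rewrite (big_setD1 p) //= expnS.
have [pp _ _ _] := primitiveP (sXP _ Xp).
apply: leq_trans (card_idealD pp (sum_primitives_idem sYP) _).
  by apply: leq_mul; [apply: leB; apply: sXP | apply: leY].
rewrite mulr_sumr big1 // => p' /setD1P[np Xp'].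
by apply: primitives_ortho; rewrite ?sXP // eq_sym.
Qed.

Lemma card_prims e : e * e = e -> e * o = e ->
  (B ^ #|prims e| <= #|ideal e|)%N.
Proof.
move=> ee eo; rewrite [e in ideal e](sum_prims ee eo); apply: card_ideal_sum.
by apply/subsetP => p /primsP[].
Qed.

(* A non-unit of the ideal of e is killed by some primitive p <= e. *)
Lemma card_units_of e : (2 * #|primitives| <= B)%N ->
  (0 < B)%N -> e * e = e -> e * o = e ->
  (#|ideal e| <= 2 * #|units_of e|)%N.
Proof.
move=> leP B0 ee eo; pose X := \bigcup_(p in prims e) ideal (e - p).
have sub : ideal e :\: units_of e \subset X.
  apply/subsetP => x /setDP[/[dup] xA /idealP xe xU].
  pose f := e - supp x.
  have se : supp x * e = supp x by apply: supp_le.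
  have f0 : f != 0.
    by apply: contra xU => /eqP/subr0_eq es; rewrite inE xA -es eqxx.
  have ff : f * f = f.
    by rewrite /f !(mulrBl, mulrBr) ee supp_idem (mulrC e) se subrr subr0.
  have fe : f * e = f by rewrite mulrBl ee se.
  have [|p /primsP[pP pf]] := prims_neq0 ff _ f0; first by rewrite -fe -mulrA eo.
  have pe : p * e = p by rewrite -pf -mulrA fe.
  apply/bigcupP; exists p; first by rewrite inE pP pe /=.
  have xp : x * p = 0 by rewrite -pf mulrCA mulrBr xe mulr_supp subrr mulr0.
  by apply/idealP; rewrite mulrBr xe xp subr0.
(* [ideal e] contains the direct sum of [ideal (e - p)] and [ideal p], so each set in the union is
   at most a fraction 1/B of it. *)
have cardX : (#|X| * B <= #|primitives| * #|ideal e|)%N.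
  apply: (@leq_trans ((\sum_(p in prims e) #|ideal (e - p)%R|) * B)).
    by rewrite leq_mul2r leq_card_bigcup orbT.
  rewrite big_distrl /=.
  apply: (@leq_trans (\sum_(p in prims e) #|ideal e|)%N).
    apply: leq_sum => p /primsP[pP pe]; have [pp _ _ _] := primitiveP pP.
    apply: (@leq_trans (#|ideal (e - p)%R| * #|ideal p|)).
      by rewrite leq_mul2l leB ?orbT.
    have := @card_idealD (e - p) p; rewrite subrK; apply=> //.
      by rewrite !(mulrBl, mulrBr) ee pp (mulrC e) pe subrr subr0.
    by rewrite mulrBl mulrC pe pp subrr.
  rewrite sum_nat_const leq_mul2r; apply/orP; right.
  by apply/subset_leq_card/subsetP => p /primsP[].
have := subset_leq_card sub; rewrite cardsD.
have -> : ideal e :&: units_of e = units_of e.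
  by apply/setIidPr/subsetP => x; rewrite inE => /andP[].
nia.
Qed.

End Primitive.

(** * Symmetric and unitary elements for an involution *)

Section Involution.
Variables (bar : {rmorphism R -> R}) (o : R).
Hypotheses (barK : involutive bar) (oo : o * o = o) (bar_o : bar o = o).
Hypothesis nontriv : forall f, f * f = f -> f * o = f -> f != 0 ->
  exists z, z * f != bar z * f.

Definition sym_of e : {set R} := [set x in ideal e | bar x == x].
Definition unitary e : {set R} := [set u in ideal e | u * bar u == e].

Lemma bar_supp x : bar (supp x) = supp (bar x).
Proof. exact: rmorphXn. Qed.

Lemma bar_qinv x : bar (qinv x) = qinv (bar x).
Proof. exact: rmorphXn. Qed.

Lemma unitaryP e u : reflect (u * e = u /\ u * bar u = e) (u \in unitary e).
Proof. by rewrite !inE; apply: (iffP andP) => -[/eqP ? /eqP ?]. Qed.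

Lemma units_ofP e u : reflect (u * e = u /\ supp u = e) (u \in units_of e).
Proof. by rewrite !inE; apply: (iffP andP) => -[/eqP ? /eqP ?]. Qed.

Section FixedIdempotent.
Variable e : R.
Hypotheses (ee : e * e = e) (eo : e * o = e) (bar_e : bar e = e).

Lemma bar_ideal x : x * e = x -> bar x * e = bar x.
Proof. by move=> xe; rewrite -bar_e -rmorphM xe. Qed.

(* Hilbert 90: an [x] for which [x + u * bar x] has the largest possible
   support must reach the whole of [e], since otherwise [nontriv] enlarges it. *)
Lemma hilbert90 u : u \in unitary e ->
  exists2 x, x * e = x & supp (x + u * bar x) = e.
Proof.
case/unitaryP => ue uu; pose tr x := x + u * bar x.
pose Q x := x * e == x; have Q0 : Q 0 by rewrite /Q mul0r.
case: (arg_maxnP (fun x => #|ideal (supp (tr x))|) Q0) => x /eqP/= xe max_x.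
exists x => //; apply/eqP; apply: contraT => ns.
pose s := supp (tr x); pose f := e - s.
have ye : tr x * e = tr x by rewrite mulrDl xe -mulrA bar_ideal.
have se : s * e = s by apply: supp_le.
(* [tr x] and its conjugate are associated, since [u * bar (tr x) = tr x]. *)
have bar_s : bar s = s.
  rewrite /s bar_supp; apply: (@supp_assoc _ _ (bar u) u).
    rewrite rmorphD rmorphM barK mulrDr mulrA (mulrC (bar u) u) uu.
    by rewrite (mulrC e) bar_ideal // addrC.
  by rewrite rmorphD rmorphM barK mulrDr mulrA uu (mulrC e) xe addrC.
have ff : f * f = f.
  by rewrite /f !(mulrBl, mulrBr) ee supp_idem (mulrC e) se subrr subr0.
have fe : f * e = f by rewrite mulrBl ee se.
have sf : s * f = 0 by rewrite mulrBr se supp_idem subrr.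
have bar_f : bar f = f by rewrite rmorphB bar_e bar_s.
have f0 : f != 0 by rewrite subr_eq0 eq_sym.
(* The choice [z = f] works unless [u * f = - f]; in that case the trace of [z * f] is
   [z * f - bar z * f], nonzero for the [z] from [nontriv]. *)
have [z zf tz] : exists2 z, z * f = z & tr z != 0.
  have [uf|] := eqVneq (f + u * f) 0; last first.
    by move=> nz; exists f => //; rewrite /tr bar_f.
  have [|z nz] := nontriv ff _ f0; first by rewrite -fe -mulrA eo.
  exists (z * f); first by rewrite -mulrA ff.
  rewrite /tr rmorphM bar_f mulrCA -[u * f](addKr f) uf addr0 mulrN.
  by rewrite subr_eq0.
pose y2 := tr z.
have y2f : y2 * f = y2.
  by rewrite /y2 /tr mulrDl zf -mulrA -bar_f -rmorphM zf.
have yy2 : tr x * y2 = 0.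
  by rewrite -y2f -(mulr_supp (tr x)) -/s mulrACA sf mulr0.
have y2s : supp y2 * s = 0.
  by apply: mulr_supp_eq0; rewrite -y2f -mulrA (mulrC f) sf mulr0.
(* Cutting [x] down to [x * s] leaves its trace unchanged, and adding [z] contributes a nonzero
   orthogonal term, which enlarges the support. *)
have trE : tr (x * s + z) = tr x + y2.
  rewrite /y2 /tr rmorphD rmorphM bar_s mulrDr addrACA; congr (_ + _).
  by rewrite mulrA -mulrDl mulr_supp.
have x'e : Q (x * s + z).
  by rewrite /Q mulrDl -mulrA se -zf -!mulrA fe.
have := max_x _ x'e; rewrite leqNgt proper_card // trE suppD // -/s.
rewrite properE; apply/andP; split.
  by apply: idealS; rewrite mulrDr supp_idem (mulrC s) y2s addr0.
apply/subsetPn; exists (supp y2).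
  by apply/idealP; rewrite mulrDr y2s supp_idem add0r.
by rewrite inE y2s eq_sym; apply: contra tz => /eqP/supp_eq0/eqP.
Qed.

Lemma unitaryN : - e \in unitary e.
Proof. by apply/unitaryP; rewrite mulNr ee rmorphN bar_e mulrNN. Qed.

(** Applied to [- e], [hilbert90] yields [w] with [w - bar w] a unit of [ideal e], so a symmetric
    pair [(s, t)] is determined by [s + w * t]. *)
Lemma card_sym_of : (#|sym_of e| ^ 2 <= #|ideal e|)%N.
Proof.
have [w we] := hilbert90 unitaryN; rewrite mulNr (mulrC e) bar_ideal // => suw.
rewrite -mulnn -cardsX.
apply: (@leq_card_inj_in _ _ _ _ (fun z => z.1 + w * z.2)); last first.
  move=> [s t] /setXP[/= /setIdP[/idealP se _] /setIdP[/idealP te _]].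
  by apply/idealP; rewrite mulrDl -mulrA se te.
move=> [s t] [s' t'] /setXP[/= /setIdP[_ /eqP bs]].
move=> /setIdP[/idealP te /eqP bt] /setXP[/= /setIdP[_ /eqP bs']].
move=> /setIdP[/idealP te' /eqP bt'] eq_st.
have eq_st' := congr1 bar eq_st.
rewrite !rmorphD !rmorphM bs bs' bt bt' in eq_st'.
have wt : (w - bar w) * (t - t') = 0.
  have := congr2 (fun a b => a - b) eq_st eq_st' => /eqP.
  rewrite -subr_eq0 => /eqP eq0; rewrite -[RHS]eq0; ring.
have tt : t = t'.
  have /eqP := mulr_supp_eq0 wt; rewrite suw mulrC mulrBl te te' subr_eq0.
  by move/eqP.
by move: eq_st; rewrite tt => /addIr ->.
Qed.

(** The norm [v * bar v] is symmetric, and dividing by one member maps a fibre of it injectively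
    into the unitary group. *)
Lemma card_units_of_unitary : (#|units_of e| <= #|sym_of e| * #|unitary e|)%N.
Proof.
apply: (@leq_card_fibres _ _ _ _ (fun v => v * bar v)).
  move=> v /units_ofP[ve _]; rewrite inE; apply/andP; split.
    by apply/idealP; rewrite -mulrA bar_ideal.
  by rewrite rmorphM barK mulrC.
move=> s _; have [->|[v0]] := set_0Vmem [set x in units_of e | x * bar x == s].
  by rewrite cards0.
rewrite inE => /andP[/units_ofP[v0e v0s] /eqP v0n].
apply: (@leq_card_inj_in _ _ _ _ (fun v => v * qinv v0)).
  move=> v v'; rewrite !inE => /andP[/andP[/eqP ve _] _].
  move=> /andP[/andP[/eqP ve' _] _] /(congr1 ( *%R^~ v0)).
  by rewrite -!mulrA ![qinv _ * _]mulrC mulr_qinv v0s ve ve'.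
move=> v; rewrite !inE => /andP[/andP[/eqP ve _] /eqP vn]; apply/andP; split.
  by rewrite mulrAC ve.
rewrite rmorphM mulrACA vn -v0n bar_qinv mulrACA !mulr_qinv -bar_supp v0s.
by rewrite bar_e ee.
Qed.

(** By [hilbert90] the quotient of [v] by [bar v] maps the units onto the unitary group, with fibres
    at least as large as the set [Y] of symmetric units. The norm has fibres no larger than the
    unitary group. Comparing the two counts, the set [X] of norms, contained in [Y], fills [Y]. *)
Lemma norm_surjective s : s \in units_of e -> bar s = s ->
  exists2 v, v \in units_of e & v * bar v = s.
Proof.
move=> sU bs; pose Y := [set t in units_of e | bar t == t].
have bar_units v : v \in units_of e -> bar v \in units_of e.
  move=> /units_ofP[ve vs]; apply/units_ofP; rewrite bar_ideal // -bar_supp vs.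
  by rewrite bar_e.
have unitsM v w : v \in units_of e -> w \in units_of e -> v * w \in units_of e.
  move=> /units_ofP[ve vs] /units_ofP[we ws]; apply/units_ofP.
  by rewrite mulrAC ve suppM vs ws.
have le1 : (#|unitary e| * #|Y| <= #|units_of e|)%N.
  apply: (@geq_card_fibres _ _ _ _ (fun v => v * qinv (bar v))).
    move=> v vU; have /units_ofP[bve bvs] := bar_units _ vU.
    case/units_ofP: vU => ve vs; apply/unitaryP; split; first by rewrite mulrAC ve.
    rewrite rmorphM bar_qinv barK mulrACA (mulrC (qinv _)) mulrACA.
    by rewrite !mulr_qinv bvs vs.
  move=> u uU; have [x xe xs] := hilbert90 uU; case/unitaryP: uU => ue uu.
  set v0 := x + u * bar x in xs.
  have v0e : v0 * e = v0 by rewrite mulrDl xe -mulrA bar_ideal.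
  have v0U : v0 \in units_of e by apply/units_ofP.
  have uv0 : u * bar v0 = v0.
    by rewrite rmorphD rmorphM barK mulrDr mulrA uu (mulrC e) xe addrC.
  have /units_ofP[_ bv0s] := bar_units _ v0U.
  apply: (@leq_card_inj_in _ _ _ _ (fun t => v0 * t)).
    move=> t t'; rewrite !inE => /andP[/andP[/eqP te _] _].
    move=> /andP[/andP[/eqP te' _] _] /(congr1 ( *%R (qinv v0))).
    by rewrite !mulrA ![qinv _ * _]mulrC mulr_qinv xs !(mulrC e) te te'.
  move=> t; rewrite [in X in X -> _]inE => /andP[tU /eqP bt].
  rewrite inE unitsM //= rmorphM bt /qinv exprMn -!/(qinv _) mulrACA.
  have -> : v0 * qinv (bar v0) = u by rewrite -{1}uv0 -mulrA mulr_qinv bv0s.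
  by case/units_ofP: tU => _; rewrite mulr_qinv => ->; rewrite ue.
pose X := [set v * bar v | v in units_of e].
have le2 : (#|units_of e| <= #|X| * #|unitary e|)%N.
  apply: (@leq_card_fibres _ _ _ _ (fun v => v * bar v)).
    by move=> v vU; apply: imset_f.
  move=> _ /imsetP[v0 /units_ofP[v0e v0s] ->].
  apply: (@leq_card_inj_in _ _ _ _ (fun v => v * qinv v0)).
    move=> v v'; rewrite !inE => /andP[/andP[/eqP ve _] _].
    move=> /andP[/andP[/eqP ve' _] _] /(congr1 ( *%R^~ v0)).
    by rewrite -!mulrA ![qinv _ * _]mulrC mulr_qinv v0s ve ve'.
  move=> v; rewrite !inE => /andP[/andP[/eqP ve _] /eqP vn]; apply/andP; split.
    by rewrite mulrAC ve.
  rewrite rmorphM mulrACA vn bar_qinv mulrACA !mulr_qinv -bar_supp v0s.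
  by rewrite bar_e ee.
have U0 : (0 < #|unitary e|)%N.
  by apply/card_gt0P; exists (- e); apply: unitaryN.
have XY : X == Y.
  rewrite eqEcard; apply/andP; split.
    apply/subsetP => _ /imsetP[v vU ->].
    by rewrite inE unitsM ?bar_units //= rmorphM barK mulrC.
  by rewrite -(leq_pmul2l U0) (leq_trans le1) // mulnC.
have : s \in X by rewrite (eqP XY) inE sU bs /=.
by case/imsetP => v vU ->; exists v.
Qed.

End FixedIdempotent.

(** * Elements of norm [- o] and the counting argument *)

Definition antiunitary : {set R} := [set b in ideal o | b * bar b == - o].

Lemma antiunitaryP b :
  reflect (b * o = b /\ b * bar b = - o) (b \in antiunitary).
Proof. by rewrite !inE; apply: (iffP andP) => -[/eqP ? /eqP ?]. Qed.

(** [- o] is a symmetric unit, hence a norm. *)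
Lemma antiunitary_neq0 : exists b, b \in antiunitary.
Proof.
have [||v vU vn] := @norm_surjective o oo oo bar_o (- o).
- by apply/units_ofP; rewrite mulNr oo suppN supp_id.
- by rewrite rmorphN bar_o.
by case/units_ofP: vU => vo _; exists v; apply/antiunitaryP.
Qed.

(** The join of two idempotents; its ideal is the smallest bar-invariant one that contains [a]. *)
Definition hull a := supp a + supp (bar a) - supp a * supp (bar a).

Lemma hull_idem a : hull a * hull a = hull a.
Proof.
have ss := supp_idem a; have tt := supp_idem (bar a); rewrite /hull.
set s := supp a in ss *; set t := supp (bar a) in tt *.
rewrite -[in RHS]ss -[in RHS]tt !(mulrBl, mulrBr, mulrDl, mulrDr).
have -> : s * (s * t) = s * t by rewrite mulrA ss.
have -> : t * (s * t) = s * t by rewrite mulrCA tt.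
have -> : s * t * s = s * t by rewrite mulrAC ss.
have -> : s * t * t = s * t by rewrite -mulrA tt.
have -> : s * t * (s * t) = s * t by rewrite mulrACA ss tt.
have -> : s * s * (t * t) = s * t by rewrite ss tt.
ring.
Qed.

Lemma bar_hull a : bar (hull a) = hull a.
Proof. by rewrite /hull rmorphB rmorphD rmorphM !bar_supp barK; ring. Qed.

Lemma supp_hull a : supp a * hull a = supp a.
Proof. by rewrite !(mulrBr, mulrDr) mulrA !supp_idem addrK. Qed.

Lemma mulr_hull a : a * hull a = a.
Proof. by rewrite -{1}(mulr_supp a) -mulrA supp_hull mulr_supp. Qed.

Lemma hull_le a : a * o = a -> hull a * o = hull a.
Proof.
move=> ao; have bao : bar a * o = bar a by rewrite -bar_o -rmorphM ao.
have so : supp a * o = supp a by apply: supp_le.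
have sbo : supp (bar a) * o = supp (bar a) by apply: supp_le.
by rewrite /hull mulrBl mulrDl -mulrA so sbo.
Qed.

Lemma hull_neq0 a : a != 0 -> hull a != 0.
Proof. by apply: contra => /eqP h0; rewrite -(mulr_hull a) h0 mulr0. Qed.

(* The fibre has constant value on the hull of a, so multiplying it by the
   unitary elements of the hull gives disjoint translates in antiunitary. *)
Lemma card_antiunitary_fibre a d : a * o = a ->
  (#|[set b in antiunitary | a * b == d]%R| * #|unitary (hull a)|
     <= #|antiunitary|)%N.
Proof.
move=> ao; set e := hull a; rewrite -cardsX.
have ee : e * e = e := hull_idem a.
have eo : e * o = e := hull_le ao.
have be : bar e = e := bar_hull a.
have eE : e = hull a by []; clearbody e.
(* A unitary element of the hull is extended by the identity on the complement [o - e]. *)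
apply: (@leq_card_inj_in _ _ _ _ (fun z => z.1 * (z.2 + (o - e)))); last first.
  move=> [b u] /setXP[/= /setIdP[/antiunitaryP[bo bb] _] /unitaryP[ue uu]].
  apply/antiunitaryP; split; first by rewrite mulrAC bo.
  have bue : bar u * e = bar u by rewrite -be -rmorphM ue.
  have uo : u * o = u by rewrite -ue -mulrA eo.
  have buo : bar u * o = bar u by rewrite -bue -mulrA eo.
  rewrite rmorphM !rmorphD rmorphN bar_o be mulrACA bb.
  suff -> : (u + (o - e)) * (bar u + (o - e)) = o by rewrite mulNr oo.
  have -> : (u + (o - e)) * (bar u + (o - e)) = u * bar u + (u * o - u * e)
      + (bar u * o - bar u * e) + (o * o - e * o - e * o + e * e) by ring.
  by rewrite uu uo ue buo bue oo eo ee; ring.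
move=> [b u] [b' u'] /setXP[/= /setIdP[/antiunitaryP[bo bb] /eqP ab]].
move=> /unitaryP[ue uu] /setXP[/= /setIdP[/antiunitaryP[bo' bb'] /eqP ab']].
move=> /unitaryP[ue' uu'] eqz.
have ann0 : supp a * (b - b') = 0.
  by apply: mulr_supp_eq0; rewrite mulrBr ab ab' subrr.
(* Since [b * bar b = - o], [b] is minus the inverse of [bar b]; hence agreement of [bar b] and
   [bar b'] on an ideal is agreement of [b] and [b'] there. *)
have ann1 : supp (bar a) * (b - b') = 0.
  have := congr1 bar ann0; rewrite rmorphM bar_supp rmorph0 rmorphB => ann.
  have -> : b - b' = b * o - b' * o by rewrite bo bo'.
  have -> : o = - (b' * bar b') by rewrite bb' opprK.
  have -> : b * - (b' * bar b') = b * b' * (- bar b') by ring.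
  have -> : - (b' * bar b') = - (b * bar b) by rewrite bb bb'.
  have -> : supp (bar a) * (b * b' * - bar b' - b' * - (b * bar b)) =
    b * b' * (supp (bar a) * (bar b - bar b')) by ring.
  by rewrite ann mulr0.
have be' : b * e = b' * e.
  apply/eqP; rewrite -subr_eq0 -mulrBl mulrC eE /hull !(mulrBl, mulrDl).
  by rewrite -!mulrA ann0 ann1 mulr0 subr0 addr0.
have equ : u = u'.
  have mul_e c v : v * e = v -> c * (v + (o - e)) * e = c * e * v.
    move=> ve; have -> : c * (v + (o - e)) * e =
      c * (v * e) + c * (e * o - e * e) by ring.
    by rewrite ee eo subrr mulr0 addr0 mulrAC -mulrA ve.
  have cancel_b v : v * e = v -> - (b * e * v * bar b) = v.
    move=> ve; have -> : - (b * e * v * bar b) = - (b * bar b) * (v * e) by ring.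
    by rewrite bb opprK ve -ve mulrC -mulrA eo.
  have := congr1 (fun z => - (z * e * bar b)) eqz.
  by rewrite /= !mul_e // -be' !cancel_b.
congr pair => //.
have split_o c : c * o = c * (o - e) + c * e by ring.
rewrite -bo -bo' !split_o be'; congr (_ + _).
have := congr1 (fun z => z * (o - e)) eqz; rewrite /= -equ.
have cut_u c : c * (u + (o - e)) * (o - e) = c * (o - e).
  rewrite -mulrA; congr (_ * _).
  have uo : u * o = u by rewrite -ue -mulrA eo.
  have -> : (u + (o - e)) * (o - e) =
    (u * o - u * e) + (o * o - e * o - e * o + e * e) by ring.
  by rewrite uo ue oo eo ee; ring.
by rewrite !cut_u.
Qed.


Definition light_pairs (light : pred (R * R)) e : {set R * R} :=
  [set c in setX (ideal e) (ideal e) | light c].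

(* First-moment argument, grouping the candidate codewords (a, ab) by the hull
   of a; distinct hulls have distinct sets of primitives below them. *)
Lemma exists_antiunitary_avoiding (light : pred (R * R)) M :
  (2 * #|primitives o| < M)%N ->
  (forall e, e * e = e -> e * o = e -> bar e = e -> e != 0 ->
     (#|light_pairs light e| * M ^ #|prims o e| <= #|unitary e|)%N) ->
  exists2 b, b \in antiunitary &
    forall a, a * o = a -> a != 0 -> ~~ light (a, a * b).
Proof.
move=> ltM le_unitary; pose D := antiunitary; pose P := primitives o.
pose E := [set e | [&& e * e == e, e * o == e, bar e == e & e != 0]].
pose bad e := [set b in D | [exists a, [&& a * o == a, a != 0, hull a == e
                                        & light (a, a * b)]]].
have card_bad e : e \in E -> (#|bad e| * M ^ #|prims o e| <= #|D|)%N.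
  rewrite inE => /and4P[/eqP ee /eqP eo /eqP be e0].
  have leU := le_unitary e ee eo be e0.
  (* [L] lists the light pairs whose first entry has hull [e]; every bad [b] multiplies the first
     entry of one of them to the second. *)
  pose L := [set c in light_pairs light e | (c.1 * o == c.1) && (hull c.1 == e)].
  have badL : bad e \subset \bigcup_(c in L) [set b in D | c.1 * b == c.2].
    apply/subsetP => b; rewrite inE => /andP[bD /existsP[a]].
    move=> /and4P[/eqP ao a0 /eqP ha la]; apply/bigcupP; exists (a, a * b).
      rewrite !inE /= -ha mulr_hull ao la mulrAC mulr_hull !eqxx /=.
      by [].
    by rewrite inE bD /= eqxx.
  have card_bad : (#|bad e| * #|unitary e| <= #|L| * #|D|)%N.
    apply: (@leq_trans
       (\sum_(c in L) (#|[set b in D | c.1 * b == c.2]%R| * #|unitary e|))).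
      rewrite -big_distrl leq_mul2r; apply/orP; right.
      exact: leq_trans (subset_leq_card badL) (leq_card_bigcup _ _).
    rewrite -sum_nat_const; apply: leq_sum => c; rewrite inE.
    by move=> /and3P[_ /eqP co /eqP <-]; apply: card_antiunitary_fibre.
  have leL : (#|L| <= #|light_pairs light e|)%N.
    by apply/subset_leq_card/subsetP => c; rewrite inE => /andP[].
  have [L0|Lpos] := posnP #|L|.
    have -> : #|bad e| = 0%N; last by rewrite mul0n.
    apply/eqP; rewrite -leqn0 (leq_trans (subset_leq_card badL)) //.
    by rewrite (cards0_eq L0) big_set0 cards0.
  rewrite -(leq_pmul2l Lpos); apply: leq_trans card_bad.
  rewrite mulnCA leq_mul2l; apply/orP; right.
  by apply: leq_trans leU; rewrite leq_mul2r leL orbT.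
suff [b bD nb] : exists2 b, b \in D & b \notin \bigcup_(e in E) bad e.
  exists b => // a ao a0; apply: contra nb => la; apply/bigcupP.
  exists (hull a).
    by rewrite inE hull_idem hull_le // bar_hull hull_neq0 // !eqxx.
  by rewrite inE bD; apply/existsP; exists a; rewrite ao a0 la !eqxx.
apply/exists_inP; rewrite -negb_forall_in; apply/negP => /forall_inP sub.
pose m := #|P|.
have prims_le e : (#|prims o e| <= m)%N.
  by apply/subset_leq_card/subsetP => p /primsP[].
have Dle : (#|D| * M ^ m <= \sum_(e in E) #|bad e| * M ^ m)%N.
  rewrite -big_distrl leq_mul2r; apply/orP; right.
  apply: leq_trans (leq_card_bigcup _ _); apply: subset_leq_card.
  apply/subsetP => b bD; exact: sub.
(* Nonzero idempotents correspond to nonempty sets of primitives; the missing empty set accounts for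
   the term [M ^ m]. *)
have sumE : (\sum_(e in E) M ^ (m - #|prims o e|) + M ^ m <= M.+1 ^ m)%N.
  rewrite -sum_subsets_expn (bigD1 set0) ?sub0set //= cards0 subn0 addnC.
  rewrite leq_add2l.
  have inj : {in E &, injective (prims o)}.
    move=> e f; rewrite !inE => /and4P[/eqP ee /eqP eo _ _].
    by move=> /and4P[/eqP ff /eqP fo _ _]; apply: prims_inj.
  rewrite -(big_imset (fun X : {set R} => M ^ (m - #|X|))%N inj) /=.
  rewrite [leqRHS](bigID [in prims o @: E]) /=; apply: leq_trans (leq_addr _ _).
  rewrite leq_eqVlt; apply/orP; left; apply/eqP/eq_bigl => X.
  apply/idP/idP => [/[dup] XE /imsetP[e]|/andP[] //]; rewrite inE XE andbT.
  move=> /and4P[/eqP ee /eqP eo _ e0] ->; apply/andP; split.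
    by apply/subsetP => p /primsP[].
  by have [p pP] := prims_neq0 ee eo e0; apply/set0Pn; exists p.
have Dbad : (\sum_(e in E) #|bad e| * M ^ m
             <= #|D| * \sum_(e in E) M ^ (m - #|prims o e|))%N.
  rewrite big_distrr; apply: leq_sum => e eE /=.
  rewrite -{1}(subnKC (prims_le e)) expnD mulnA leq_mul2r.
  by rewrite card_bad ?orbT.
have D0 : (0 < #|D|)%N by have [b bD] := antiunitary_neq0; apply/card_gt0P; exists b.
have := leq_trans Dle Dbad; rewrite leq_pmul2l // => leM.
(* The proportions sum to at most ((M + 1)^m - M^m) / M^m, which is below 1. *)
have := expn_succ_lt2 ltM; rewrite -/m; lia.
Qed.

End Involution.
End FiniteReducedRing.

Lemma leq_exp2rW k m n : (m <= n)%N -> (m ^ k <= n ^ k)%N.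
Proof. by case: k => // k lemn; rewrite leq_exp2r. Qed.

(** * Words of low weight *)

Section LowWeightWords.
Variables (F : finFieldType) (J : finType).
Local Notation q := #|F|.

Definition wt (f : {ffun J -> F}) : nat := #|[set j | f j != 0]|.

Lemma card_field_ge2 : (2 <= q)%N.
Proof.
rewrite (cardD1 0) (cardD1 1) !inE oner_eq0 /=; lia.
Qed.

(* The generating function of T ^ (#|J| - wt f) over all f is
   (T + q - 1) ^ #|J|. *)
Lemma card_wt_le T w : (0 < T)%N ->
  (#|[set f : {ffun J -> F} | wt f <= w]| * T ^ #|J|
     <= T ^ w * (T + q) ^ #|J|)%N.
Proof.
move=> T0.
have gen : (\sum_(f : {ffun J -> F}) T ^ (#|J| - wt f) <= (T + q) ^ #|J|)%N.
  apply: (@leq_trans (\prod_(j : J) \sum_(c : F) if c == 0%R then T else 1)%N).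
    rewrite bigA_distr_bigA /=; apply: leq_sum => f _.
    rewrite (bigID (fun j => f j == 0)) /=.
    rewrite [X in (_ <= _ * X)%N]big1 ?muln1; last first.
      by move=> j /negPf->.
    rewrite (eq_bigr (fun=> T)); last by move=> j ->.
    rewrite prod_nat_const leq_pexp2l //.
    rewrite /wt -(cardsC [set j | f j != 0]) addKn subset_leq_card //.
    by apply/subsetP => j; rewrite !inE negbK.
  rewrite prod_nat_const leq_exp2rW //.
  rewrite (bigD1 0) //= eqxx leq_add2l.
  rewrite (eq_bigr (fun=> 1%N)); last by move=> c /negPf->.
  by rewrite sum1_card max_card.
(* A word of weight at most [w] contributes at least [T ^ (#|J| - w)] to the generating function. *)
rewrite -sum_nat_const; apply: (@leq_trans
  (\sum_(f in [set f : {ffun J -> F} | wt f <= w]%N) T ^ w * T ^ (#|J| - wt f))).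
  apply: leq_sum => f; rewrite inE => lew; rewrite -expnD leq_pexp2l //.
  by rewrite -leq_subLR leq_sub2l.
rewrite -big_distrr leq_mul2l /=; apply/orP; right; apply: leq_trans gen.
by rewrite [leqRHS](bigID [in [set f | wt f <= w]%N]) /= leq_addr.
Qed.

(* With T = 33 q one has ((T + q) / T) ^ 16 <= 2, and w <= k / (8 T) gives
   T ^ (8 w) <= 2 ^ k. *)
Definition wt_factor := (8 * (33 * q))%N.

Lemma card_low_wt k : #|J| = (2 * k)%N ->
  (#|[set f : {ffun J -> F} | (wt_factor * wt f <= k)%N]| ^ 4 <= q ^ k)%N.
Proof.
move=> cardJ; have q2 := card_field_ge2; pose T := (33 * q)%N.
have T0 : (0 < T)%N by rewrite /T; lia.
have fac0 : (0 < 8 * T)%N by lia.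
pose w := (k %/ (8 * T))%N.
have -> : [set f : {ffun J -> F} | wt_factor * wt f <= k]%N
  = [set f : {ffun J -> F} | wt f <= w]%N.
  by apply/setP => f; rewrite !inE /wt_factor -/T mulnC leq_divRL.
set V := #|_|; have leV : (V * T ^ (2 * k) <= T ^ w * (T + q) ^ (2 * k))%N.
  by rewrite -cardJ; apply: card_wt_le.
(* 33 is the least [M] with [2 * 16 < M], as [expn_succ_lt2] requires. *)
have leT : ((T + q) ^ 16 <= 2 * T ^ 16)%N.
  have gen m M : (2 * m < M)%N -> ((M * q + q) ^ m <= 2 * (M * q) ^ m)%N.
    move=> /expn_succ_lt2 /ltnW leM.
    by rewrite addnC -mulSn !expnMn mulnA leq_mul2r leM orbT.
  exact: gen.
clearbody T.
have le2k : (T ^ (8 * w) <= 2 ^ k)%N.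
  apply: (@leq_trans ((2 ^ T) ^ (8 * w))); first by apply/leq_exp2rW/ltnW/ltn_expl.
  by rewrite -expnM leq_pexp2l // mulnCA mulnA mulnC /w leq_trunc_div.
have le8 : (V ^ 8 * T ^ (16 * k) <= (2 ^ k * 2 ^ k) * T ^ (16 * k))%N.
  have := leq_exp2rW 8 leV; rewrite !expnMn -!expnM.
  have -> : (2 * k * 8 = 16 * k)%N by lia.
  move=> /leq_trans; apply.
  rewrite [(w * 8)%N]mulnC -mulnA; apply: leq_mul le2k _.
  by rewrite !(expnM _ 16) -expnMn leq_exp2rW.
have T16 : (0 < T ^ (16 * k))%N by rewrite expn_gt0 T0.
rewrite leq_pmul2r // in le8.
rewrite -(@leq_exp2r _ _ 2) // -expnM; apply: leq_trans le8 _.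
by rewrite mulnn; apply/leq_exp2rW/leq_exp2rW.
Qed.

End LowWeightWords.

(** * Information sets and averaging over the group *)

Section InformationSet.
Variables (F : finFieldType) (gT : finGroupType).
Local Notation FG := (galg F gT).
Local Notation q := #|F|.
Variable V : {set FG}.
Hypotheses (V0 : 0 \in V) (VD : forall a b, a \in V -> b \in V -> a + b \in V)
  (VZ : forall (c : F) a, a \in V -> c *: a \in V).

Lemma gcoef_sum (I : finType) (P : pred I) (f : I -> FG) x :
  gcoef (\sum_(i | P i) f i) x = \sum_(i | P i) gcoef (f i) x.
Proof. by rewrite /gcoef sum_ffunE. Qed.

Lemma gcoef0 x : gcoef (0 : FG) x = 0.
Proof. exact: ffunE. Qed.

Lemma gcoefN (a : FG) x : gcoef (- a) x = - gcoef a x.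
Proof. exact: ffunE. Qed.

Definition separates (I : {set gT}) :=
  [forall a in V, [forall x in I, gcoef a x == 0] ==> (a == 0)].

Lemma separatesP (I : {set gT}) : reflect
  (forall a, a \in V -> (forall x, x \in I -> gcoef a x = 0) -> a = 0)
  (separates I).
Proof.
apply: (iffP forall_inP) => sep a aV.
  move=> a0; apply/eqP; apply: (implyP (sep a aV)).
  by apply/forall_inP => x /a0->.
apply/implyP => /forall_inP a0; apply/eqP/sep => // x /a0 /eqP //.
Qed.

Lemma separates_inj (I : {set gT}) : separates I -> {in V &, forall a b,
  (forall x, x \in I -> gcoef a x = gcoef b x) -> a = b}.
Proof.
move=> /separatesP sep a b aV bV eq_ab; apply/eqP; rewrite -subr_eq0; apply/eqP.
apply: sep => [|x Ix]; first by apply: VD; rewrite // -scaleN1r; apply: VZ.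
by rewrite gcoefD gcoefN eq_ab // subrr.
Qed.

(** A separating set of least size works. By minimality each of its points has a word of [V] that is
    nonzero there and vanishes on the rest of the set; scaled, these words form a dual basis, so
    restriction to the set is bijective. *)
Lemma information_set : exists2 I : {set gT}, separates I & #|V| = (q ^ #|I|)%N.
Proof.
have sepT : separates setT.
  by apply/separatesP => a _ a0; apply: gcoefP => x; rewrite a0 ?inE // gcoef0.
case: (arg_minnP (fun I : {set gT} => #|I|) sepT) => I sepI minI.
exists I => //; pose Y := [set f in pffun_on (0 : F) [in I] predT].
have YP (f : {ffun gT -> F}) :
    reflect (forall x, x \notin I -> f x = 0) (f \in Y).
  rewrite inE; apply: (iffP pffun_onP) => [[/subsetP sf _] x nx|f0].
    by apply/eqP; apply: contraR nx => fx; apply: sf.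
  by split=> //; apply/subsetP => x; rewrite inE; apply: contraR => /f0->.
have cardY : #|Y| = (q ^ #|I|)%N.
  by rewrite cardsE card_pffun_on; congr (_ ^ _)%N; apply: eq_card.
apply/eqP; rewrite -cardY eqn_leq; apply/andP; split.
  apply: (@leq_card_inj_in _ _ _ _
    (fun a : FG => [ffun x => if x \in I then gcoef a x else 0])).
    move=> a b aV bV /ffunP eq_ab; apply: (separates_inj sepI) => // x Ix.
    by have := eq_ab x; rewrite !ffunE Ix.
  by move=> a _; apply/YP => x /negPf nx; rewrite ffunE nx.
(* The membership test sits inside the existential so that one choice function exists on all of
   [gT]. *)
have dual i : exists a : FG, i \in I -> a \in V /\
    (forall x, x \in I -> gcoef a x = (x == i)%:R).
  have [Ii|] := boolP (i \in I); last by exists 0.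
  have /separatesP nsep : ~~ separates (I :\ i).
    apply/negP => /minI; rewrite (cardsD1 i I) Ii; lia.
  have : ~~ separates (I :\ i) by apply/separatesP.
  rewrite negb_forall_in => /exists_inP[a aV]; rewrite negb_imply.
  move=> /andP[/forall_inP a0 nz].
  have ai : gcoef a i != 0.
    apply: contra nz => /eqP ai; apply/eqP.
    apply: (separatesP _ sepI) => // x Ix.
    by have [->//|nxi] := eqVneq x i; apply/eqP/a0; rewrite !inE nxi.
  exists ((gcoef a i)^-1 *: a) => _; split; first exact: VZ.
  move=> x Ix; rewrite gcoefZ; have [->|nxi] := eqVneq x i.
    by rewrite mulVf.
  by rewrite (eqP (a0 x _)) ?mulr0 // !inE nxi.
have [c cP] := fin_all_exists dual.
have cV i : i \in I -> c i \in V by move=> /cP[].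
have ci i x : i \in I -> x \in I -> gcoef (c i) x = (x == i)%:R.
  by move=> /cP[_ cix]; apply: cix.
apply: (@leq_card_inj_in _ _ _ _
  (fun f : {ffun gT -> F} => \sum_(i in I) f i *: c i)).
  have eval (f : {ffun gT -> F}) x : x \in I ->
      gcoef (\sum_(i in I) f i *: c i) x = f x.
    move=> Ix; rewrite gcoef_sum (bigD1 x) //= gcoefZ ci // eqxx mulr1.
    rewrite big1 ?addr0 // => i /andP[Ii ni].
    by rewrite gcoefZ ci // eq_sym (negPf ni) mulr0.
  move=> f g /YP f0 /YP g0 eq_fg; apply/ffunP => x.
  have [Ix|nx] := boolP (x \in I); last by rewrite f0 ?g0.
  by rewrite -(eval f) // eq_fg eval.
move=> f _; elim/big_rec: _ => // i a Ii aV.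
by apply: VD => //; apply: VZ; apply: cV.
Qed.

Lemma gcoef_gelt_mul g (a : FG) z : gcoef (gelt F g * a) z = gcoef a (g^-1 * z)%g.
Proof.
rewrite gcoefM (bigD1 g) //= gcoefE eqxx mul1r big1 ?addr0 // => x nx.
by rewrite gcoefE (negPf nx) mul0r.
Qed.

Hypothesis VG : forall g a, a \in V -> gelt F g * a \in V.

(* Averaging over G: some translate of a word of relative weight delta has
   relative weight at most delta on a given information set. *)
Lemma card_light_pairs :
  (#|[set c in setX V V | (wt_factor F * weight c <= #|gT|)%N]| ^ 4
     <= #|gT| ^ 4 * #|V|)%N.
Proof.
have [I sepI cardV] := information_set; set n := #|gT|; pose k := #|I|.
have n0 : (0 < n)%N by apply/card_gt0P; exists 1%g.
pose J := ({x : gT | x \in I} * bool)%type.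
have cardJ : #|{: J}| = (2 * k)%N.
  by rewrite card_prod card_sig card_bool mulnC; congr (_ * _)%N; apply: eq_card.
pose comp (c : FG * FG) (b : bool) := if b then c.1 else c.2.
pose res c : {ffun J -> F} := [ffun j => gcoef (comp c j.2) (val j.1)].
pose shift g (c : FG * FG) : FG * FG := (gelt F g * c.1, gelt F g * c.2).
have compS g c b : comp (shift g c) b = gelt F g * comp c b by case: b.
pose W := [set c in setX V V | (wt_factor F * wt (res c) <= k)%N].
have cardW : (#|W| ^ 4 <= q ^ k)%N.
  apply: leq_trans (card_low_wt F cardJ); apply: leq_exp2rW.
  apply: (@leq_card_inj_in _ _ _ _ res); last first.
    by move=> c /setIdP[_]; rewrite inE.
  move=> [a b] [a' b'] /setIdP[/setXP[/= aV bV] _] /setIdP[/setXP[/= aV' bV'] _].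
  move=> /ffunP eq_r; congr pair; apply: (separates_inj sepI) => // x Ix.
    by have := eq_r (exist _ x Ix, true); rewrite !ffunE.
  by have := eq_r (exist _ x Ix, false); rewrite !ffunE.
(* Each coordinate of [I] meets every coordinate of the word exactly once as [g] runs over the
   group. *)
have sum_wt c : (\sum_(g : gT) wt (res (shift g c)) = k * weight c)%N.
  have wtE g : wt (res (shift g c)) =
      (\sum_(j : J) (gcoef (comp c j.2) (g^-1 * val j.1)%g != 0%R))%N.
    rewrite /wt cardsE -sum1_card big_mkcond /=; apply: eq_bigr => j _.
    by rewrite unfold_in /= /res ffunE compS gcoef_gelt_mul; case: (_ != 0).
  under eq_bigr => g _ do rewrite wtE.
  rewrite exchange_big /=.
  have inner_sum (j : J) :
     (\sum_(g : gT) (gcoef (comp c j.2) (g^-1 * val j.1)%g != 0%R)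
       = gweight (comp c j.2))%N.
    have inj : injective (fun g : gT => val j.1 * g^-1)%g.
      by move=> g h /mulgI /invg_inj.
    rewrite (reindex_inj inj) /gweight cardsE -sum1_card [RHS]big_mkcond /=.
    apply: eq_bigr => g _; rewrite ?unfold_in /= invMg invgK mulgKV.
    by case: (_ != 0).
  under eq_bigr => j _ do rewrite inner_sum.
  rewrite -(pair_big predT predT (fun _ b => gweight (comp c b))) /=.
  rewrite sum_nat_const big_bool /= /weight; congr (_ * _)%N.
  by rewrite card_sig; apply: eq_card.
have subL : [set c in setX V V | (wt_factor F * weight c <= n)%N]
    \subset \bigcup_(g : gT) [set shift g c | c in W].
  apply/subsetP => c /setIdP[cV light_c].
  have [aV bV] : c.1 \in V /\ c.2 \in V by case: (c) cV => a b /setXP.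
  have [g leg] : exists g : gT, (n * wt (res (shift g c)) <= k * weight c)%N.
    apply/existsP; apply: contraT; rewrite negb_exists => /forallP gt_all.
    have : (\sum_(g : gT) (k * weight c).+1 <=
            \sum_(g : gT) n * wt (res (shift g c)))%N.
      by apply: leq_sum => g _; rewrite ltnNge.
    by rewrite sum_nat_const -big_distrr /= sum_wt leq_pmul2l // ltnn.
  apply/bigcupP; exists g^-1%g => //; apply/imsetP; exists (shift g c).
    apply/setIdP; split; first by apply/setXP; split; apply: VG.
    rewrite -(leq_pmul2l n0) mulnCA.
    apply: (@leq_trans (wt_factor F * (k * weight c))).
      by rewrite leq_mul2l leg orbT.
    by rewrite mulnCA [leqRHS]mulnC leq_mul2l light_c orbT.
  rewrite /shift /= !mulrA -!geltM mulVg.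
  by case: (c) => a b /=; rewrite !mul1r.
have le_nW : (#|[set c in setX V V | (wt_factor F * weight c <= n)%N]|
    <= n * #|W|)%N.
  apply: leq_trans (subset_leq_card subL) _.
  apply: leq_trans (leq_card_bigcup _ _) _.
  by rewrite -sum_nat_const; apply: leq_sum => g _; apply: leq_imset_card.
apply: leq_trans (leq_exp2rW 4 le_nW) _.
by rewrite expnMn leq_mul2l cardV cardW orbT.
Qed.

End InformationSet.

(** * Cyclotomic cosets and minimal ideals of the group algebra *)

Section CyclotomicBound.
Variables q n : nat.
Hypothesis n_gt1 : (1 < n)%N.

(** The first [d] iterates exhaust the orbit of [c], which is a non-trivial coset. *)
Lemma mu_q_le_period (c : 'Z_n) d :
  c != 0 -> (0 < d)%N -> iter d (@qmult q n) c = c -> (mu_q q n <= d)%N.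
Proof.
move=> c0 d0 per; pose Q := cyclotomic_coset q c.
have cQ : c \in Q by rewrite inE -fconnect_orbit connect0.
apply: (@leq_trans #|Q|); last first.
  rewrite -(size_traject (@qmult q n) c d); apply: leq_trans (card_size _).
  apply/subset_leq_card/subsetP => y; rewrite inE => /trajectP[i _ ->].
  apply/loopingP; rewrite /looping per; case: (d) d0 => //= m _.
  by rewrite inE eqxx.
rewrite /mu_q -leEnat -minEnat; apply: bigmin_le_cond; rewrite imset_f //=.
by apply: contra c0 => /eqP Q0; rewrite -in_set1 -Q0.
Qed.

Lemma mu_q_leq : (mu_q q n <= n)%N.
Proof. by rewrite /mu_q; elim/big_rec: _ => // Q x _ lex; rewrite geq_min lex orbT. Qed.

Lemma mu_q_gt0 : (0 < mu_q q n)%N.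
Proof.
rewrite /mu_q; elim/big_ind: _ => [|x y x0 y0|Q /andP[/imsetP[c _ ->] _]].
- exact: ltnW.
- by rewrite leq_min x0.
by apply/card_gt0P; exists c; rewrite inE -fconnect_orbit connect0.
Qed.

End CyclotomicBound.

Section PrimitiveUnits.
Variables (R : finComNzRingType) (N : nat) (o : R).
Hypotheses (N_gt0 : (0 < N)%N) (exprN1 : forall x : R, x ^+ N.+1 = x).

(** [ideal p] is a field with identity [p], and Fermat's argument applies: multiplication by [y]
    permutes its nonzero elements, whose product is then cancelled. *)
Lemma expr_primitive p y : p \in primitives o -> y * p = y -> y != 0 ->
  y ^+ #|ideal p|.-1 * p = p.
Proof.
move=> pP yp y0; have [pp _ p0 minp] := primitiveP pP.
have supp_p x : x * p = x -> x != 0 -> supp N x = p.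
  move=> xp x0; apply: minp.
  - exact: supp_idem.
  - by rewrite supp_le.
  - by apply: contra x0 => /eqP/supp_eq0 ->.
pose X := ideal p :\ 0; pose z := \prod_(x in X) x.
have zp : supp N z * p = p.
  rewrite /z; elim/big_rec: _ => [|x w]; first by rewrite /supp expr1n mul1r.
  rewrite !inE => /andP[x0 /eqP xp] IH.
  by rewrite suppM supp_p // -mulrA mulrCA pp IH.
have yz : y ^+ #|X| * z = z.
  rewrite /z -prodr_const -big_split /=.
  have injy : {in X &, injective (fun x => y * x)}.
    move=> x x'; rewrite !inE => /andP[_ /eqP xp] /andP[_ /eqP xp'].
    move=> /(congr1 ( *%R (qinv N y))); rewrite !mulrA ![qinv N y * _]mulrC.
    by rewrite mulr_qinv // supp_p // !(mulrC p) xp xp'.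
  suff XE : [set y * x | x in X] = X by rewrite -(big_imset id injy) /= XE.
  apply/eqP; rewrite eqEcard card_in_imset // leqnn andbT.
  apply/subsetP => _ /imsetP[w wX ->]; move: wX; rewrite !inE.
  move=> /andP[w0 /eqP wp]; rewrite -mulrA wp eqxx andbT.
  apply: contra w0 => /eqP yw; rewrite -wp -(supp_p y) //.
  by rewrite mulrC mulr_supp_eq0.
have cX : #|ideal p|.-1 = #|X|.
  by rewrite /X (cardsD1 0 (ideal p)) inE mul0r eqxx.
rewrite cX -{1}zp -(mulr_qinv N_gt0 exprN1) !mulrA yz mulr_qinv //.
Qed.

(** Bezout for the exponents [n] and [#|ideal p|.-1], both of which send [y] to [p]. *)
Lemma expr_primitive_gcdn p y n : p \in primitives o -> y * p = y -> y != 0 ->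
  y ^+ n = p -> (1 < #|ideal p|)%N -> y ^+ gcdn n #|ideal p|.-1 = p.
Proof.
move=> pP yp y0 yn A1; have [pp _ _ _] := primitiveP pP.
set m := #|ideal p|.-1; have m0 : (0 < m)%N by rewrite /m; lia.
have ppow k : p ^+ k * p = p.
  by elim: k => [|k IH]; rewrite ?mul1r // exprS -mulrA IH.
have ym : y ^+ m * p = p by apply: expr_primitive.
rewrite gcdnC; have [km kn def_g _] := egcdnP n m0.
have g0 : (0 < gcdn m n)%N by rewrite gcdn_gt0 m0.
have ypow k : (0 < k)%N -> p * y ^+ k = y ^+ k.
  by case: k => // k _; rewrite exprS mulrA [p * y]mulrC yp.
have ymp : y ^+ (km * m) * p = p.
  rewrite mulnC exprM; elim: (km) => [|k IH]; first by rewrite mul1r.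
  by rewrite exprS -mulrA IH.
have ynp : y ^+ (kn * n) * p = p by rewrite mulnC exprM yn ppow.
by rewrite -ypow // -{1}ynp mulrAC -exprD -def_g.
Qed.

End PrimitiveUnits.

(** * The group algebra of an abelian group as a ring with involution *)

Section CommutativeGroupAlgebra.
Variables (F : finFieldType) (gT : finGroupType).
Hypothesis abG : abelian [set: gT].

Lemma mulgC_abelian (x y : gT) : (x * y = y * x)%g.
Proof. by apply: (centsP abG); rewrite inE. Qed.

Lemma gmulC (a b : galg F gT) : a * b = b * a.
Proof.
apply: gcoefP => z; rewrite gcoefM gcoef_gmul; apply: eq_bigr => x _.
by rewrite mulrC (mulgC_abelian z).
Qed.

(* The proof of commutativity is an argument of the type, so that the
   commutative ring structure can be inferred from it. *)
Definition abelian_galg of abelian [set: gT] : Type := galg F gT.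
Local Notation cgalg := (abelian_galg abG).
HB.instance Definition _ := Finite.on cgalg.
HB.instance Definition _ := GRing.Algebra.on cgalg.
HB.instance Definition _ := GRing.PzRing_hasCommutativeMul.Build cgalg gmulC.

Lemma gcoef_bar (a : galg F gT) z : gcoef (bar a) z = gcoef a z^-1%g.
Proof.
rewrite /bar gcoef_sum (bigD1 z^-1%g) //= gcoefZ gcoefE invgK eqxx mulr1.
rewrite big1 ?addr0 // => x nx; rewrite gcoefZ gcoefE.
by rewrite -[z]invgK (inj_eq invg_inj) eq_sym (negPf nx) mulr0.
Qed.

Definition cbar (a : cgalg) : cgalg := bar a.

Lemma cbar_is_zmod_morphism : zmod_morphism cbar.
Proof.
move=> a b; apply: gcoefP => z.
by rewrite gcoefD gcoefN !gcoef_bar gcoefD gcoefN.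
Qed.

Lemma cbar_is_monoid_morphism : monoid_morphism cbar.
Proof.
split=> [|a b]; apply: gcoefP => z.
  by rewrite gcoef_bar !gcoefE -{1}invg1 (inj_eq invg_inj).
rewrite gcoef_bar !gcoefM [RHS](reindex_inj invg_inj); apply: eq_bigr => x _.
by rewrite !gcoef_bar !invgK invMg mulgC_abelian.
Qed.

HB.instance Definition _ :=
  GRing.isZmodMorphism.Build cgalg cgalg cbar cbar_is_zmod_morphism.
HB.instance Definition _ :=
  GRing.isMonoidMorphism.Build cgalg cgalg cbar cbar_is_monoid_morphism.

Lemma cbarK : involutive cbar.
Proof. by move=> a; apply: gcoefP => z; rewrite !gcoef_bar invgK. Qed.

Lemma geltX (x : gT) k : (gelt F x : cgalg) ^+ k = gelt F (x ^+ k)%g.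
Proof. by elim: k => [|k IH] //; rewrite exprS IH expgS geltM. Qed.

Lemma cbar_gelt (x : gT) : cbar (gelt F x) = gelt F x^-1%g.
Proof.
apply: gcoefP => z; rewrite gcoef_bar !gcoefE.
by rewrite -[z in RHS]invgK (inj_eq invg_inj).
Qed.

Local Notation q := #|F|.
Local Notation n := #|gT|.
Hypotheses (n_gt1 : (1 < n)%N) (n_coprime : coprime n q) (n_odd : odd n).

(* Since q ^ totient n = 1 modulo n, this power fixes the scalars and G. *)
Lemma galg_expr_fixed (a : cgalg) : a ^+ (q ^ totient n).-1.+1 = a.
Proof.
have q0 : (0 < q ^ totient n)%N by rewrite expn_gt0; have := card_field_ge2 F; lia.
rewrite prednK //.
(* [q] is a power of the characteristic, which makes the power map additive. *)
have chF : [pchar cgalg].-nat q.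
  have [p pr_p pF] := finPcharP F.
  have : p.-nat q.
    have /abelem_pgroup := @fin_ring_pchar_abelem p F pF.
    by rewrite /pgroup cardsT.
  apply: sub_in_pnat => r _ /eqP ->.
  by have := pchar_lalg cgalg p; rewrite !unfold_in => ->.
have chq : [pchar cgalg].-nat (q ^ totient n)%N by rewrite pnatX chF.
have powD (I : finType) (f : I -> cgalg) :
    (\sum_i f i) ^+ (q ^ totient n) = \sum_i f i ^+ (q ^ totient n).
  apply: (big_morph (fun x : cgalg => x ^+ (q ^ totient n))).
    by move=> x y; apply: exprDn_pchar.
  by rewrite expr0n; case: (q ^ totient n)%N q0.
have powF (c : F) : c ^+ (q ^ totient n) = c.
  by elim: (totient n) => [|k IH]; rewrite ?expn0 ?expr1 // expnSr exprM IH expf_card.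
have powG (x : gT) : (x ^+ (q ^ totient n) = x)%g.
  have : (q ^ totient n = 1 %[mod n])%N.
    by apply: Euler_exp_totient; rewrite coprime_sym.
  move=> e; rewrite (divn_eq (q ^ totient n) n) e modn_small // expgD expg1.
  by rewrite mulnC expgM -cardsT expg_cardG ?inE // expg1n mul1g.
rewrite {1}[a](gelt_sum (a : galg F gT)) powD [RHS](gelt_sum (a : galg F gT)).
apply: eq_bigr => x _.
by rewrite exprZn geltX powF powG.
Qed.

Lemma pow_gt0 : (0 < (q ^ totient n).-1)%N.
Proof.
have t0 : (0 < totient n)%N by rewrite totient_gt0 ltnW.
have := leq_pexp2l (ltnW (card_field_ge2 F)) t0; rewrite expn1.
have := card_field_ge2 F; lia.
Qed.

Local Notation e0c := (e0 F gT : cgalg).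
Local Notation o := (one_dag F gT : cgalg).

Lemma natr_card_neq0 : (n%:R : F) != 0.
Proof.
apply/negP => /eqP n0; have [p pr_p pF] := finPcharP F.
have pn : (p %| n)%N by rewrite (dvdn_pcharf pF) n0.
have pq : (p %| q)%N.
  have /abelem_pgroup := @fin_ring_pchar_abelem p F pF.
  rewrite /pgroup cardsT => pq.
  have /p_natP[k qk] := pq; rewrite qk; case: k qk => [qk|k _].
    by have := card_field_ge2 F; rewrite qk expn0.
  by rewrite dvdn_exp.
have : (p %| gcdn n q)%N by rewrite dvdn_gcd pn.
rewrite (eqP n_coprime) dvdn1 => /eqP p1.
by rewrite p1 in pr_p.
Qed.

Lemma gcoef_e0 z : gcoef (e0 F gT) z = n%:R^-1.
Proof.
rewrite /e0 gcoefZ gcoef_sum (bigD1 z) //= gcoefE eqxx big1 ?addr0 ?mulr1 //.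
by move=> x nx; rewrite gcoefE eq_sym (negPf nx).
Qed.

Lemma mul_e0 (a : cgalg) : a * e0c = (\sum_x gcoef a x) *: e0c.
Proof.
apply: gcoefP => z; rewrite gcoefM gcoefZ gcoef_e0 mulr_suml.
by apply: eq_bigr => x _; rewrite gcoef_e0.
Qed.

Lemma e0_idem : e0c * e0c = e0c.
Proof.
rewrite mul_e0; under eq_bigr => x _ do rewrite gcoef_e0.
by rewrite sumr_const -[_ *+ _]mulr_natl mulfV ?natr_card_neq0 // scale1r.
Qed.

Lemma one_dag_idem : o * o = o.
Proof. by rewrite /one_dag mulrBl mul1r mulrBr mulr1 e0_idem subrr subr0. Qed.

Lemma cbar_one_dag : cbar o = o.
Proof.
apply: gcoefP => z; rewrite gcoef_bar /one_dag !gcoefD !gcoefN !gcoef_e0.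
by rewrite !gcoefE -{1}invg1 (inj_eq invg_inj).
Qed.

(** If the whole group fixed [f], averaging would give [e0 * f = f], whereas [f * o = f] means
    [e0 * f = 0]. *)
Lemma one_dag_moved (f : cgalg) : f * o = f -> f != 0 ->
  exists g, (gelt F g : cgalg) * f != f.
Proof.
move=> fo f0; apply/existsP; apply: contraT; rewrite negb_exists => /forallP fix_f.
case/eqP: f0; have fix_g g : (gelt F g : cgalg) * f = f.
  by apply/eqP; move: (fix_f g); rewrite negbK.
have : e0c * f = f.
  rewrite /e0 -scalerAl mulr_suml (eq_bigr (fun=> f)); last by move=> g _.
  by rewrite sumr_const -(scaler_nat _ f) scalerA mulVf ?natr_card_neq0 ?scale1r.
by move: fo; rewrite /one_dag mulrBr mulr1 mulrC => + e0f; rewrite e0f subrr => <-.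
Qed.

(* |G| is odd, so an element fixed by all squares of G is fixed by G. *)
Lemma one_dag_nontriv (f : cgalg) : f * f = f -> f * o = f -> f != 0 ->
  exists z, z * f != cbar z * f.
Proof.
move=> _ fo f0; have [g gf] := one_dag_moved fo f0.
exists (gelt F g); rewrite cbar_gelt; apply: contra gf => /eqP eq_f.
have g2f : (gelt F (g * g)%g : cgalg) * f = f.
  by rewrite geltM -mulrA eq_f mulrA -geltM mulgV mul1r.
(* As [g ^ n = 1] with [n] odd, [g] is the power [(n + 1) / 2] of its square. *)
have -> : g = ((g * g) ^+ n./2.+1)%g.
  rewrite -expg2 -expgM.
  have -> : (2 * n./2.+1 = n.+1)%N by have := odd_double_half n; rewrite n_odd; lia.
  by rewrite expgS -cardsT expg_cardG ?inE // mulg1.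
rewrite -geltX; apply/eqP; elim: (n./2.+1) => [|k IH]; first by rewrite mul1r.
by rewrite exprSr -mulrA g2f.
Qed.

Lemma ideal_closed (e : cgalg) : [/\ 0 \in ideal e,
  forall a b, a \in ideal e -> b \in ideal e -> a + b \in ideal e,
  forall (c : F) a, a \in ideal e -> c *: a \in ideal e &
  forall g a, a \in ideal e -> (gelt F g : cgalg) * a \in ideal e].
Proof.
split=> [|a b|c a|g a]; rewrite !inE ?mul0r //.
- by move=> /eqP ae /eqP be; rewrite mulrDl ae be.
- by move=> /eqP ae; rewrite -scalerAl ae.
- by move=> /eqP ae; rewrite -mulrA ae.
Qed.

Lemma card_ideal_pow (e : cgalg) : exists k, #|ideal e| = (q ^ k)%N.
Proof.
have [V0 VD VZ _] := ideal_closed e.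
by have [I _ cI] := @information_set F gT (ideal e) V0 VD VZ; exists #|I|.
Qed.

(** Some group element [g] gives a nontrivial [n]-th root of unity [g * p] in the field [ideal p] of
    order [q ^ d]. Hence [t = gcd(n, q ^ d - 1)] exceeds 1, and multiplication by [q ^ d] fixes the
    nonzero residue [n / t], whose coset has at most [d] elements. *)
Lemma card_primitive_ideal (p : cgalg) : p \in primitives o ->
  (q ^ mu_q q n <= #|ideal p|)%N.
Proof.
move=> pP; have [pp po p0 _] := primitiveP pP.
have [g gp] := one_dag_moved po p0.
have q2 := card_field_ge2 F.
have A2 : (1 < #|ideal p|)%N.
  rewrite (cardsD1 0) inE mul0r eqxx (cardsD1 p) !inE p0 pp eqxx; lia.
have [d cA] := card_ideal_pow p; rewrite cA leq_pexp2l ?(ltnW q2) //.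
have d0 : (0 < d)%N by case: d cA => // cA; rewrite cA in A2.
pose y := (gelt F g : cgalg) * p.
have yp : y * p = y by rewrite /y -mulrA pp.
have ppow k : p ^+ k.+1 = p by elim: k => // k IH; rewrite exprS IH.
have yn : y ^+ n = p.
  rewrite exprMn geltX -cardsT expg_cardG ?inE // mul1r cardsT.
  by case: (n) n_gt1.
have y0 : y != 0.
  apply/negP => /eqP y0; have := yn; rewrite y0 expr0n; case: (n) n_gt1 => //= m _.
  by move=> /esym/eqP; apply/negP.
have := expr_primitive_gcdn pow_gt0 galg_expr_fixed pP yp y0 yn A2.
set t := gcdn _ _ => yt.
have t_n : (t %| n)%N := dvdn_gcdl _ _.
have t0 : (0 < t)%N by rewrite gcdn_gt0 (ltnW n_gt1).
have t1 : (1 < t)%N.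
  rewrite ltn_neqAle t0 andbT; apply: contra gp => /eqP t1.
  by rewrite -/y -[X in _ == X]yt -t1 expr1.
apply: (@mu_q_le_period q n (n %/ t)%:R) => //.
  apply/negP => /eqP/(congr1 val); rewrite /= val_Zp_nat //.
  rewrite modn_small ?ltn_Pdiv ?(ltnW n_gt1) //.
  by apply/eqP; rewrite -lt0n divn_gt0 // dvdn_leq // ltnW.
have -> k : iter k (@qmult q n) ((n %/ t)%:R : 'Z_n) = (q ^ k * (n %/ t))%:R.
  by elim: k => [|k IH]; rewrite ?mul1n //= IH /qmult -natrM mulnA -expnS.
have -> : (q ^ d = (q ^ d).-1 + 1)%N by rewrite addn1 prednK // expn_gt0 ltnW.
rewrite mulnDl mul1n natrD -cA.
have /dvdnP[m ->] : (t %| #|ideal p|.-1)%N := dvdn_gcdr _ _.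
rewrite -mulnA [(t * _)%N]mulnC divnK // natrM.
have -> : (n%:R : 'Z_n) = 0 by apply: val_inj; rewrite /= val_Zp_nat // modnn.
by rewrite mulr0 add0r.
Qed.

Lemma card_galg : #|{: cgalg}| = (q ^ n)%N.
Proof. by rewrite card_ffun. Qed.

(** The sum of the primitive ideals is direct and each has at least [q] elements, while the whole
    algebra has [q ^ n]. *)
Lemma card_primitives : (#|primitives o| <= n)%N.
Proof.
have q2 := card_field_ge2 F.
have := card_ideal_sum card_primitive_ideal (subxx (primitives o)).
move=> /leq_trans/(_ (max_card _)); rewrite card_galg -expnM leq_exp2l //.
by apply: leq_trans; rewrite leq_pmull // mu_q_gt0.
Qed.

Local Notation N := (q ^ totient n).-1.

(* With K the size of the ideal, L the number of light pairs, U the size of the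
   unitary group and s the number of primitives: L^4 <= n^4 K, K <= 4 U^2 and
   (4n)^(8s) <= K, so (L (4n)^s)^4 <= K^2 / 16 <= U^4. *)
Lemma light_pairs_unitary (e : cgalg) : ((4 * n) ^ 8 <= q ^ mu_q q n)%N ->
  e * e = e -> e * o = e -> cbar e = e -> e != 0 ->
  (#|light_pairs (fun c : cgalg * cgalg => wt_factor F * weight c <= n)%N e|
     * (4 * n) ^ #|prims o e| <= #|unitary cbar e|)%N.
Proof.
move=> le_mu ee eo be e_neq0.
have [V0 VD VZ VG] := ideal_closed e.
have leL := @card_light_pairs F gT (ideal e) V0 VD VZ VG.
set L := #|light_pairs _ _|; set s := #|prims _ _|; set U := #|unitary _ _|.
set K := #|ideal e| in leL.
have {}leL : (L ^ 4 <= n ^ 4 * K)%N by apply: leL.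
have leP := card_primitives.
have n4 : (2 * n <= (4 * n) ^ 8)%N.
  have : (4 * n <= (4 * n) ^ 8)%N.
    by rewrite -{1}[(4 * n)%N]expn1 leq_pexp2l //; move: n_gt1; lia.
  lia.
have leK : (((4 * n) ^ 8) ^ s <= K)%N.
  apply: leq_trans (leq_exp2rW _ le_mu) _.
  exact: (card_prims card_primitive_ideal ee eo).
have leU : (K <= 2 * #|units_of N e|)%N.
  apply: (card_units_of pow_gt0 galg_expr_fixed card_primitive_ideal) => //.
    by apply: leq_trans le_mu; apply: leq_trans n4; rewrite leq_mul2l leP.
  by rewrite expn_gt0 ltnW // card_field_ge2.
have leS : (#|sym_of cbar e| ^ 2 <= K)%N.
  exact: (card_sym_of pow_gt0 galg_expr_fixed cbarK one_dag_nontriv).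
have leUS : (#|units_of N e| <= #|sym_of cbar e| * U)%N.
  exact: (card_units_of_unitary pow_gt0 galg_expr_fixed cbarK).
have s0 : (0 < s)%N.
  have [p pe] := prims_neq0 ee eo e_neq0.
  by apply/card_gt0P; exists p.
have K0 : (0 < K)%N by apply/card_gt0P; exists 0.
(* [K] is at most twice the number of symmetric elements times [U]; after squaring, one factor [K]
   cancels. *)
have K4U : (K <= 4 * U ^ 2)%N.
  rewrite -(leq_pmul2l K0) mulnn; apply: (@leq_trans ((2 * (#|sym_of cbar e| * U)) ^ 2)).
    by apply: leq_exp2rW; apply: leq_trans leU _; rewrite leq_mul2l leUS.
  have -> : ((2 * (#|sym_of cbar e| * U)) ^ 2 = #|sym_of cbar e| ^ 2 * (4 * U ^ 2))%N.
    by ring.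
  by rewrite leq_mul2r leS orbT.
rewrite -(@leq_exp2r _ _ 4) // expnMn.
have n16 : (16 * n ^ 4 <= (4 * n) ^ (4 * s))%N.
  apply: (@leq_trans ((4 * n) ^ 4)).
    by rewrite expnMn leq_mul2r; apply/orP; right.
  by rewrite leq_pexp2l ?muln_gt0 ?(ltnW n_gt1) // leq_pmulr.
have lhs : (16 * (L ^ 4 * ((4 * n) ^ s) ^ 4) <= K * K)%N.
  apply: (@leq_trans (16 * (n ^ 4 * K * ((4 * n) ^ s) ^ 4))).
    by rewrite leq_mul2l leq_mul2r leL !orbT.
  have reassoc a b c : (16 * (a * b * c) = b * (16 * a * c))%N by ring.
  rewrite reassoc.
  rewrite leq_mul2l; apply/orP; right; apply: leq_trans leK.
  have -> : (((4 * n) ^ 8) ^ s = (4 * n) ^ (4 * s) * ((4 * n) ^ s) ^ 4)%N.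
    by rewrite -!expnM -expnD; congr (_ ^ _)%N; lia.
  by rewrite leq_mul2r n16 orbT.
have rhs : (K * K <= 16 * U ^ 4)%N.
  have := leq_mul K4U K4U; congr (_ <= _)%N; ring.
have := leq_trans lhs rhs; rewrite leq_pmul2l //.
Qed.

Lemma exists_good_antiunitary : ((4 * n) ^ 8 <= q ^ mu_q q n)%N ->
  exists2 b : cgalg, b \in antiunitary cbar o &
    forall a : cgalg, a * o = a -> a != 0 -> (n < wt_factor F * weight (a, (a * b)%R))%N.
Proof.
move=> le_mu.
have [||b bD avoid] := @exists_antiunitary_avoiding cgalg N pow_gt0
  galg_expr_fixed cbar o cbarK one_dag_idem cbar_one_dag one_dag_nontriv
  (fun c => wt_factor F * weight c <= n)%N (4 * n)%N.
- apply: (@leq_ltn_trans (2 * n)); first by rewrite leq_mul2l card_primitives orbT.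
  by rewrite ltn_pmul2r // ltnW.
- by move=> e ee eo be e_neq0; apply: light_pairs_unitary.
exists b => // a ao a0; have := avoid a ao a0.
by rewrite -ltnNge.
Qed.

Lemma exists_antiunitary : exists b : cgalg, b \in antiunitary cbar o.
Proof.
exact: (antiunitary_neq0 pow_gt0 galg_expr_fixed cbarK one_dag_idem cbar_one_dag
  one_dag_nontriv).
Qed.

End CommutativeGroupAlgebra.

(** * Codes of type I *)

Section Code.
Variables (F : finFieldType) (gT : finGroupType).
Local Notation FG := (galg F gT).
Local Notation q := #|F|.
Local Notation n := #|gT|.

Definition code_map (b u : FG) : FG * FG := (u * one_dag F gT, u * b).

Lemma code_map_is_linear b : linear (code_map b).
Proof.
move=> c u v; rewrite /code_map; congr pair => /=.
  by rewrite mulrDl -scalerAl.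
by rewrite mulrDl -scalerAl.
Qed.

HB.instance Definition _ b :=
  GRing.isLinear.Build F FG (FG * FG)%type *:%R (code_map b)
    (code_map_is_linear b).

Definition dag_code b : {vspace (FG * FG)%type} := limg (linfun (code_map b)).

Lemma dag_codeP b c :
  reflect (exists u, c = code_map b u) (c \in dag_code b).
Proof.
apply: (iffP memv_imgP) => [[u _ ->]|[u ->]]; exists u; rewrite ?lfunE ?memvf //.
Qed.

Lemma dag_code_gen b : dag_code b =i code_gen2 (one_dag F gT) b.
Proof.
move=> c; apply/dag_codeP/imsetP => [[u ->]|[u _ ->]]; first by exists u.
by exists u.
Qed.

Hypotheses (abG : abelian [set: gT]) (n_coprime : coprime n q).
Local Notation R := (abelian_galg F abG).
Local Notation o := (one_dag F gT : R).
Variable b : R.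
Hypothesis bD : b \in antiunitary (@cbar F gT abG) o.

Lemma dag_code_quasi : quasi_code2 (dag_code b).
Proof.
move=> u c /dag_codeP[v ->]; apply/dag_codeP; exists (u * v).
by rewrite /code_map /= !mulrA.
Qed.

Lemma gcoef_mul_bar1 (x y : FG) : gcoef (x * bar y) 1%g = \sum_z gcoef x z * gcoef y z.
Proof.
rewrite gcoefM; apply: eq_bigr => z _.
by rewrite mulg1 gcoef_bar // invgK.
Qed.

(** The inner product of the words of [v] and [u] is the coefficient at 1 of
    [v * bar u * (o + b * bar b)], which is zero. *)
Lemma dag_code_self_orthogonal : self_orthogonal (dag_code b).
Proof.
have /antiunitaryP[bo bb] := bD.
move=> c /dag_codeP[u ->]; rewrite inE; apply/forallP => d; apply/implyP.
move=> /dag_codeP[v ->]; rewrite /inner big_split /= -!gcoef_mul_bar1 -gcoefD.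
rewrite [X in gcoef X _](_ : _ = 0) ?gcoef0 //.
change ((v : R) * o * cbar ((u : R) * o) + (v : R) * b * cbar ((u : R) * b) = 0).
rewrite !rmorphM /= cbar_one_dag.
have -> : (v : R) * o * (cbar (u : R) * o) = v * cbar (u : R) * (o * o) by ring.
have -> : (v : R) * b * (cbar (u : R) * cbar b) = v * cbar (u : R) * (b * cbar b) by ring.
by rewrite one_dag_idem // bb mulrN subrr.
Qed.

Lemma FGdagP (a : R) : reflect (a * o = a) (a \in FGdag F gT).
Proof.
apply: (iffP imsetP) => [[x _ ->]|ao]; last by exists a.
by rewrite -mulrA one_dag_idem.
Qed.

Lemma dag_code_type_I : type_I_dag (dag_code b).
Proof.
have /antiunitaryP[bo bb] := bD; exists b; split.
- exact/FGdagP.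
- exact: bb.
- exact: dag_code_gen.
Qed.

(** The kernel of [code_map b] is the line of [e0]: the first component vanishes exactly there, and
    so does the second, [b] being a multiple of [o]. *)
Lemma dim_dag_code : \dim (dag_code b) = n.-1.
Proof.
have /antiunitaryP[bo bb] := bD.
have := limg_ker_dim (linfun (code_map b)) fullv.
have -> : (fullv :&: lker (linfun (code_map b)))%VS = <[e0 F gT]>%VS.
  apply/vspaceP => u; rewrite capfv memv_ker lfunE /=.
  apply/eqP/vlineP => [[uo ub]|[k ->]].
    have ue : (u : R) * (e0 F gT : R) = u.
      apply/eqP; rewrite eq_sym -subr_eq0 -{1}[u]mulr1 -mulrBr; apply/eqP; exact: uo.
    by exists (\sum_x gcoef u x); rewrite -{1}ue mul_e0.
  have eo : (e0 F gT : R) * o = 0 by rewrite /one_dag mulrBr mulr1 e0_idem // subrr.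
  rewrite linearZ /= (_ : code_map b (e0 F gT) = 0) ?scaler0 //.
  congr pair; first exact: eo.
  change ((e0 F gT : R) * b = 0).
  by rewrite -bo mulrCA eo mulr0.
rewrite dim_vline dimvf.
have -> : e0 F gT != 0.
  apply/negP => /eqP e00; have := gcoef_e0 F (1%g : gT); rewrite e00 gcoef0.
  by move=> /esym/eqP; rewrite invr_eq0 (negPf (natr_card_neq0 n_coprime)).
rewrite -/(dag_code b).
have -> : dim FG = n by rewrite /dim /= muln1.
by move=> <-; rewrite add1n.
Qed.

(** The word of [u] is also the word of [a = u * o], whose first component is [a] itself. *)
Lemma dag_code_word (c : FG * FG) : c \in dag_code b -> c != 0 ->
  exists a : R, [/\ a * o = a, a != 0 & c = (a, a * b)].
Proof.
have /antiunitaryP[bo bb] := bD.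
move=> /dag_codeP[u ->] nz; exists ((u : R) * o).
have cE : code_map b u = ((u : R) * o, (u : R) * o * b).
  have ub : (u : R) * o * b = (u : R) * b by rewrite -mulrA (mulrC o) bo.
  by rewrite /code_map; congr pair; apply/esym/ub.
split=> //; first by rewrite -mulrA one_dag_idem.
by apply: contra nz => /eqP uo; rewrite cE uo mul0r.
Qed.

Lemma weight_gt0 (c : FG * FG) : c != 0 -> (0 < weight c)%N.
Proof.
apply: contraR; rewrite -leqNgt leqn0 addn_eq0 !cards_eq0.
case: c => x y /= /andP[/eqP x0 /eqP y0].
apply/eqP; congr pair; apply: gcoefP => z; rewrite gcoef0; apply/eqP.
  by have := in_set0 z; rewrite -x0 inE => /negbFE.
by have := in_set0 z; rewrite -y0 inE => /negbFE.
Qed.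

(** The bound on [w] covers the initial value of the minimum. *)
Lemma min_weight_geq (C : {vspace (FG * FG)%type}) w : (w <= 2 * n)%N ->
  (forall c, c \in C -> c != 0 -> (w <= weight c)%N) -> (w <= min_weight C)%N.
Proof.
move=> wn wC; rewrite /min_weight; elim/big_ind: _ => // [x y|c /andP[]].
  by rewrite leq_min => -> ->.
exact: wC.
Qed.

End Code.

(** The distance bound is conditional on a large [mu_q], which may fail at finitely many indices;
    there the unconditional positivity of the minimum weight serves instead. *)
Lemma exists_dag_code (F : finFieldType) (gT : finGroupType) :
  abelian [set: gT] -> (1 < #|gT|)%N -> coprime #|gT| #|F| -> odd #|gT| ->
  exists C : {vspace (galg F gT * galg F gT)%type},
    [/\ quasi_code2 C, self_orthogonal C, type_I_dag C, \dim C = #|gT|.-1 &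
      (0 < min_weight C)%N /\
      (((4 * #|gT|) ^ 8 <= #|F| ^ mu_q #|F| #|gT|)%N ->
         (#|gT| <= wt_factor F * min_weight C)%N)].
Proof.
move=> abG n1 co od; set n := #|gT|.
have [b bD good] : exists2 b : abelian_galg F abG,
    b \in antiunitary (@cbar F gT abG) (one_dag F gT) &
    ((4 * n) ^ 8 <= #|F| ^ mu_q #|F| n)%N -> forall a : abelian_galg F abG,
      a * one_dag F gT = a -> a != 0 ->
        (n < wt_factor F * weight (a, (a * b)%R))%N.
  have [le_mu|nle] := boolP ((4 * n) ^ 8 <= #|F| ^ mu_q #|F| n)%N.
    have [b bD good] := exists_good_antiunitary abG n1 co od le_mu.
    by exists b.
  by have [b bD] := exists_antiunitary abG n1 co od; exists b.
exists (dag_code b); split.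
- exact: dag_code_quasi.
- exact: dag_code_self_orthogonal bD.
- exact: dag_code_type_I bD.
- exact: dim_dag_code bD.
split.
  apply: min_weight_geq => [|c _]; first by rewrite muln_gt0 /= ltnW.
  exact: weight_gt0.
move=> le_mu.
have fac0 : (0 < wt_factor F)%N by rewrite !muln_gt0 /= ltnW // card_field_ge2.
have [lt2|ge2] := ltnP (2 * n) (n %/ wt_factor F).+1.
  have := leq_div n (wt_factor F); move: lt2; rewrite ltnS.
  by move: (leq_pmull n (isT : 0 < 2)%N); have := ltnW n1; rewrite -/n; lia.
have le_w : ((n %/ wt_factor F).+1 <= min_weight (dag_code b))%N.
  apply: min_weight_geq => // c cC c0.
  have [a [ao a0 ->]] := dag_code_word co bD cC c0.
  by rewrite ltn_divLR // mulnC good.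
by rewrite ltn_divLR // mulnC in le_w; apply: ltnW.
Qed.

From mathcomp Require Import all_classical all_reals all_analysis.
Import Order.TTheory GRing.Theory Num.Theory.
Import numFieldNormedType.Exports.
Local Open Scope ring_scope.

(** * Logarithmic ratios and limits *)

Lemma near_infty_ge (P : nat -> Prop) :
  (\forall i \near \oo%classic, P i) -> exists i0, forall i, (i0 <= i)%N -> P i.
Proof. by move=> [i0 _ hi]; exists i0 => i lei; apply: hi. Qed.

Lemma invr_nat_le_ratio (R : realType) (a b c : nat) :
  (0 < a)%N -> (0 < c)%N -> (c <= a * b)%N -> (a%:R : R)^-1 <= b%:R / c%:R.
Proof.
move=> a0 c0 le_c; have a0' : (0 : R) < a%:R by rewrite ltr0n.
have c0' : (0 : R) < c%:R by rewrite ltr0n.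
by rewrite ler_pdivlMr // mulrC ler_pdivrMr // -natrM ler_nat mulnC.
Qed.

Section LogRatio.
Variables (R : realType) (q n mu : nat).
Hypotheses (q_gt1 : (1 < q)%N) (n_gt1 : (1 < n)%N) (mu_gt0 : (0 < mu)%N).
Local Notation ratio := (logb (q%:R : R) n%:R / mu%:R).

Lemma ln_nat_gt0 m : (1 < m)%N -> 0 < ln (m%:R : R).
Proof. by move=> m1; rewrite ln_gt0 // ltr1n. Qed.

Lemma logb_ratio_pow k : (0 < k)%N -> ratio < k%:R^-1 -> (n ^ k <= q ^ mu)%N.
Proof.
move=> k0; rewrite /logb => ltr.
have lnq := ln_nat_gt0 q_gt1; have n0 : (0 : R) < n%:R by rewrite ltr0n ltnW.
have q0 : (0 : R) < q%:R by rewrite ltr0n ltnW.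
have mu0 : (0 : R) < mu%:R by rewrite ltr0n.
have k0' : (0 : R) < k%:R by rewrite ltr0n.
move: ltr; rewrite ltr_pdivrMr // ltr_pdivrMr // -mulrA [ltRHS]mulrC.
rewrite ltr_pdivlMr // => /ltW lekn.
rewrite -(@ler_nat R) !natrX -ler_ln ?posrE ?exprn_gt0 // !lnXn //.
by rewrite -[leLHS]mulr_natr -[leRHS]mulr_natl.
Qed.

(** The numerator is at least log_q 2, so a small ratio forces a large denominator; this is what
    sends [mu_q], and with it the length, to infinity. *)
Lemma logb_ratio_lt A :
  ratio < ln 2 / ln q%:R / A%:R -> (A < mu)%N.
Proof.
rewrite /logb => ltr; have [->//|A0] := posnP A.
have lnq := ln_nat_gt0 q_gt1; have lnn := ln_nat_gt0 n_gt1.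
have mu0 : (0 : R) < mu%:R by rewrite ltr0n.
have A0' : (0 : R) < A%:R by rewrite ltr0n.
have le2 : ln 2 <= ln (n%:R : R).
  by rewrite ler_ln ?posrE ?ltr0n ?ler_nat // ltnW.
have {ltr} : ln (n%:R : R) / ln q%:R / mu%:R < ln n%:R / ln q%:R / A%:R.
  by apply: lt_le_trans ltr _; rewrite !ler_pM2r ?invr_gt0.
by rewrite ltr_pM2l ?divr_gt0 // ltf_pV2 ?posrE // ltr_nat.
Qed.

End LogRatio.

Theorem theorem5p10 (R : realType) (F : finFieldType) (q : nat)
    (hq : #|F| = q)
    (n : nat -> nat)
    (n_odd : forall i, odd (n i))
    (n_gt1 : forall i, (1 < n i)%N)
    (n_coprime : forall i, coprime (n i) q)
    (n_lim : ((fun i => logb (q%:R : R) (n i)%:R / (mu_q q (n i))%:R) @ \oo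
                --> (0 : R))%classic)
    (G : nat -> finGroupType)
    (G_abelian : forall i, abelian [set: G i])
    (G_order : forall i, #|G i| = n i) :
  exists C : forall i, {vspace (galg F (G i) * galg F (G i))%type},
    [/\ forall i, [/\ quasi_code2 (C i), self_orthogonal (C i)
                    & type_I_dag (C i)],
        forall i, \dim (C i) = (n i).-1
      & asymptotically_good R C].
Proof.
have exC i := @exists_dag_code F (G i) (G_abelian i).
have {}exC i : exists C : {vspace (galg F (G i) * galg F (G i))%type},
    [/\ quasi_code2 C, self_orthogonal C, type_I_dag C, \dim C = (n i).-1 &
      (0 < min_weight C)%N /\
      (((4 * n i) ^ 8 <= q ^ mu_q q (n i))%N ->
         (n i <= wt_factor F * min_weight C)%N)].
  by have := exC i; rewrite hq G_order; apply.
pose C i := projT1 (cid (exC i)).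
have CP i := projT2 (cid (exC i)); rewrite -/(C _) in CP.
have q_gt1 : (1 < q)%N by rewrite -hq; apply: card_field_ge2.
have mu_gt0 i : (0 < mu_q q (n i))%N by apply: mu_q_gt0.
have ratio_lt (e : R) : 0 < e ->
    \forall i \near \oo%classic, logb (q%:R : R) (n i)%:R / (mu_q q (n i))%:R < e.
  move=> e0; have [i1 _ lt_e] := cvgr0_norm_lt _ n_lim e e0.
  by exists i1 => // i /lt_e; apply: le_lt_trans; apply: ler_norm.
exists C; split=> [i|i|].
- by have [? ? ? _ _] := CP i; split.
- by have [_ _ _ ? _] := CP i.
have [i0 good] : exists i0, forall i, (i0 <= i)%N ->
    (n i <= wt_factor F * min_weight (C i))%N.
  (* 24 is 3 * 8: a ratio below 1/24 gives [n ^ 24 <= q ^ mu], and [4 * n <= n ^ 3] because [n], odd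
     and above 1, is at least 3. *)
  have e0 : (0 : R) < 24%:R^-1 by rewrite invr_gt0 ltr0n.
  have /near_infty_ge[i0 lt_e] := ratio_lt _ e0.
  exists i0 => i /lt_e lt_i; have [_ _ _ _ [_ ]] := CP i; apply.
  have le24 := @logb_ratio_pow R q (n i) _ q_gt1 (n_gt1 i) (mu_gt0 i) 24 isT lt_i.
  apply: leq_trans le24; rewrite -[24%N]/(3 * 8)%N expnM leq_exp2r //.
  have n3 : (3 <= n i)%N by have := n_gt1 i; have := n_odd i; case: (n i) => [|[|[|]]].
  by rewrite expnSr leq_mul2r; apply/orP; right; nia.
have mw0 i : (0 < min_weight (C i))%N by have [_ _ _ _ []] := CP i.
have lenE i : code_length (C i) = (2 * n i)%N by rewrite /code_length G_order.
have n0 i : (0 : R) < (n i)%:R by rewrite ltr0n ltnW.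
split.
(* [mu_q] eventually exceeds any [A] and never exceeds [n]. *)
- apply/cvgnyPge => A.
  have e0 : (0 : R) < ln 2 / ln q%:R / A.+1%:R.
    by rewrite !divr_gt0 ?ltr0n // ln_nat_gt0.
  apply: filterS (ratio_lt _ e0) => i /logb_ratio_lt.
  move=> /(_ q_gt1 (n_gt1 i) (mu_gt0 i)) ltA.
  rewrite lenE; have := mu_q_leq q (n i); lia.
(* The rate is [(n - 1) / (2 * n)], at least 1/4 as [n >= 2]. *)
- exists 4%:R^-1 => [|i]; first by rewrite invr_gt0 ltr0n.
  have [_ _ _ dimC _] := CP i; rewrite /code_rate dimC lenE.
  by apply: invr_nat_le_ratio => //; have := n_gt1 i; lia.
(* For the finitely many [i < i0] the sum [S] bounds [n i], and a positive minimum weight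
   suffices. *)
pose S := (\sum_(i < i0) n i)%N; pose M := (wt_factor F + S)%N.
have leM i : (n i <= M * min_weight (C i))%N.
  rewrite /M mulnDl; have [/good lei|lti] := leqP i0 i.
    exact: leq_trans lei (leq_addr _ _).
  apply: leq_trans (leq_addl _ _); apply: (@leq_trans S).
    by rewrite /S (bigD1 (Ordinal lti)) //= leq_addr.
  by rewrite leq_pmulr.
have M0 : (0 < M)%N.
  by have := leM 0%N; have := n_gt1 0%N; case: (M) => //; lia.
exists ((2 * M)%:R^-1) => [|i]; first by rewrite invr_gt0 ltr0n muln_gt0.
rewrite /rel_distance lenE; apply: invr_nat_le_ratio.
- by rewrite muln_gt0.
- by rewrite muln_gt0 /= ltnW.
- by rewrite -mulnA leq_mul2l leM.
Qed.
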